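(* Let $\phi$ be a $C^2$-functional on $E$ such that $\phi'$ and $\phi''$ are $\alpha$-Hölder continuous on bounded sets for some $\alpha\in(0,1]$, and assume that $\phi|_{S_\mu}$ is even. Let $\mathcal{F}$ be a $\mathbb{Z}_2$-homotopic family of $S_\mu$ of dimension at most $n$ with boundary $B$ such that $$c:=\inf_{A\in\mathcal{F}}\max_{u\in A}\phi(u)>\max_B\phi$$ and $c$ is finite. Let $R>1$ and $0<\alpha_1\le\frac{\alpha}{2(\alpha+2)}<1$. Then there exists $\varepsilon_0>0$ such that for every $\varepsilon\in(0,\varepsilon_0)$ and for every $A\in\mathcal{F}$ with $\max_{u\in A}\phi(u)\le c+\varepsilon$ satisfying $$K:=\{u\in A:\phi(u)\ge c-\varepsilon\}\subset B(0,R-1),$$ there exists $u_\varepsilon\in S_\mu$ such that: 1. $c-\varepsilon\le\phi(u_\varepsilon)\le c+\varepsilon$; 2. $\|\phi'|_{S_\mu}(u_\varepsilon)\|_*\le3\varepsilon^{\alpha_1}$; 3. $u_\varepsilon\in A$; 4. if $W$ is a subspace of $T_{u_\varepsilon}S_\mu$ such that $D^2\phi(u_\varepsilon)[w,w]<-\varepsilon^{\alpha_1}\|w\|^2$ for all $w\in W$, $w\neq0$, then $\dim W\le n$. By symmetry, properties 1–4 also hold with $-u_\varepsilon$ in place of $u_\varepsilon$.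
   Context: Setting. $(E,\langle\cdot,\cdot\rangle)$ and $(H,(\cdot,\cdot))$ are infinite-dimensional real Hilbert spaces with continuous injections $E\hookrightarrow H\hookrightarrow E'$; the injection $E\hookrightarrow H$ has norm at most $1$ and $E$ is identified with its image in $H$. Write $\|u\|^2=\langle u,u\rangle$ and $|u|^2=(u,u)$ for $u\in E$. For a fixed $\mu\in(0,+\infty)$, $S_\mu=\{u\in E: |u|^2=\mu\}$, a codimension-one submanifold of $E$ with tangent space $T_uS_\mu=\{v\in E:(u,v)=0\}$ at $u\in S_\mu$; $S_\mu$ carries the topology induced from $E$. $B(0,r)$ is the ball of radius $r$ of $(E,\|\cdot\|)$. $\|\cdot\|_*$ and $\|\cdot\|_{**}$ denote the operator norms of $\mathcal{L}(E,\mathbb{R})$ and $\mathcal{L}(E,\mathcal{L}(E,\mathbb{R}))$. For $u\in S_\mu$, $\phi'|_{S_\mu}(u)$ denotes the differential at $u$ of the restriction of $\phi$ to $S_\mu$, a linear form on $T_uS_\mu$, and $\|\phi'|_{S_\mu}(u)\|_*$ is its dual norm with respect to the norm $\|\cdot\|$ on $T_uS_\mu$ inherited from $E$. For a $C^2$ functional $\phi$ on $E$ and $\alpha\in(0,1]$, $\phi'$ and $\phi''$ are $\alpha$-Hölder continuous on bounded sets if for any $R>0$ there is $M=M(R)>0$ such that for all $u_1,u_2\in B(0,R)$: $\|\phi'(u_1)-\phi'(u_2)\|_*\le M\|u_1-u_2\|^\alpha$ and $\|\phi''(u_1)-\phi''(u_2)\|_{**}\le M\|u_1-u_2\|^\alpha$.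 For $u\in E\setminus\{0\}$, $D^2\phi(u)$ is the continuous bilinear form $D^2\phi(u)=\phi''(u)-\frac{\phi'(u)\cdot u}{|u|^2}(\cdot,\cdot)$. A family $\mathcal{F}$ of subsets of $S_\mu$ is a $\mathbb{Z}_2$-homotopic family of dimension at most $n$ with boundary $B\subset S_\mu$ if there exist an isometric involution $S$ of $\mathbb{R}^n$ (with its usual distance), compact sets $D_0\subset D\subset\mathbb{R}^n$ with $SD=D$, $SD_0=D_0$ and $\{x\in D: Sx=x\}=\emptyset$, and a continuous map $\eta_0:D_0\to B$ which is equivariant, i.e. $\eta_0\circ S=-\eta_0$, such that $$\mathcal{F}=\{A\subset S_\mu: A=f(D)\text{ for some } f\in C(D;S_\mu)\text{ with } f\circ S=-f\text{ and } f=\eta_0\text{ on }D_0\}.$$ *)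

(* Defs.v *)
From mathcomp Require Import all_boot all_order all_algebra.
From mathcomp Require Import all_classical all_reals all_analysis.
From mathcomp Require Import ring.

Set Implicit Arguments.
Unset Strict Implicit.
Unset Printing Implicit Defensive.
Import Order.TTheory GRing.Theory Num.Theory.
Import numFieldNormedType.Exports.

Local Open Scope classical_set_scope.
Local Open Scope ring_scope.

Section LinearDimension.
Variables (R : realType) (V : lmodType R).
Implicit Type W : {pred V}.

Definition is_basis W k (b : 'I_k -> V) : Prop :=
  [/\ forall i, b i \in W,
      forall a : 'I_k -> R, \sum_i a i *: b i = 0 -> forall i, a i = 0
    & forall w, w \in W -> exists a : 'I_k -> R, w = \sum_i a i *: b i].

Definition has_dim W k : Prop := exists b : 'I_k -> V, is_basis W b.

Definition dim_le W n : Prop := exists2 k, (k <= n)%N & has_dim W k.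

Definition infinite_dim : Prop := forall k, ~ has_dim predT k.

End LinearDimension.

Arguments infinite_dim {R} V.

Section HilbertPair.
Variables (R : realType) (E H : completeNormedModType R).

Definition hilbert_product (V : completeNormedModType R)
    (dot : {dot V for idfun}) : Prop :=
  forall u, dot u u = `|u| ^+ 2.

(* The injection of [H] into the dual of [E] sends [h] to [(h, j _)].  It is
   continuous because [j] and the inner product are; its injectivity says that
   the image of [E] is dense in [H]. *)
Definition hilbert_embedding (dotH : {dot H for idfun}) (j : {linear E -> H})
    : Prop :=
  [/\ injective j, forall u, `|j u| <= `|u|
    & injective (fun (h : H) (u : E) => dotH h (j u))].

(* The inner product of [H], on elements of [E]. *)
Definition pullback (dotH : {dot H for idfun}) (j : {linear E -> H})
    (u v : E) : R := dotH (j u) (j v).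

End HilbertPair.

Section OperatorNorms.
Variables (R : realType) (E : normedModType R).

(* Norm of a linear form on the subspace [T] of [E]; it takes the value [+oo]
   exactly on the unbounded forms. *)
Definition dual_norm (T : set E) (l : E -> R) : \bar R :=
  ereal_sup [set `|l v|%:E | v in [set v | T v /\ `|v| <= 1]].

(* Norm of [b] as a map from [E] to its dual. *)
Definition bilin_norm (b : E -> E -> R) : \bar R :=
  ereal_sup [set dual_norm setT (b v) | v in [set v | `|v| <= 1]].

End OperatorNorms.

Section SecondDerivative.
Variables (R : realType) (E : normedModType R).
Implicit Types (phi : E -> R) (u : E).

(* [b] is the Frechet derivative at [u] of [fun w => 'd phi w], as a map from
   [E] to its dual. *)
Definition is_hess phi u (b : E -> E -> R) : Prop :=
  [/\ bilinear_for *%R *%R b, (bilin_norm b < +oo)%E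
    & forall e : R, 0 < e -> \forall h \near (0 : E),
        (dual_norm setT (fun v => ('d phi (u + h) v - 'd phi u v - b h v)%R)
           <= (e * `|h|)%:E)%E].

Definition hess phi u : E -> E -> R := get (is_hess phi u).

Definition C2 phi : Prop :=
  [/\ forall u, differentiable phi u,
      forall u, is_hess phi u (hess phi u)
    & forall u (e : R), 0 < e -> \forall w \near u,
        (bilin_norm (fun h v => (hess phi w h v - hess phi u h v)%R)
           <= e%:E)%E].

Definition holder_on_bounded (alpha : R) phi : Prop :=
  forall r : R, 0 < r -> exists2 M : R, 0 < M &
    forall u1 u2, ball (0 : E) r u1 -> ball (0 : E) r u2 ->
      (dual_norm setT (fun v => ('d phi u1 v - 'd phi u2 v)%R)
         <= (M * `|u1 - u2| `^ alpha)%:E)%E /\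
      (bilin_norm (fun h v => (hess phi u1 h v - hess phi u2 h v)%R)
         <= (M * `|u1 - u2| `^ alpha)%:E)%E.

End SecondDerivative.

Section Sphere.
Variables (R : realType) (E : normedModType R).
(* In use, [q] is the inner product of [H] restricted to [E]. *)
Variable q : E -> E -> R.

Definition sphere (mu : R) : set E := [set u | q u u = mu].

Definition tangent (u : E) : set E := [set v | q u v = 0].

(* Value at [v] of the differential at [u] of the restriction of [phi] to the
   sphere: the derivative of [phi] along a curve on the sphere that passes
   through [u] with velocity [v]. *)
Definition sphere_diff (mu : R) (phi : E -> R) (u v : E) : R :=
  get [set d : R | exists gamma : R -> E,
    [/\ \forall t \near (0 : R), sphere mu (gamma t), gamma 0 = u,
        is_derive (0 : R) 1 gamma v & is_derive (0 : R) 1 (phi \o gamma) d]].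

Definition constrained_norm (mu : R) (phi : E -> R) (u : E) : \bar R :=
  dual_norm (tangent u) (sphere_diff mu phi u).

Definition D2 (phi : E -> R) (u v w : E) : R :=
  hess phi u v w - 'd phi u u / q u u * q v w.

End Sphere.

Lemma is_derive_along (R : realType) (E : normedModType R) (phi : E -> R)
    (gamma : R -> E) (u v : E) :
  differentiable phi u -> gamma 0 = u -> is_derive (0 : R) 1 gamma v ->
  is_derive (0 : R) 1 (phi \o gamma) ('d phi u v).
Proof.
move=> dphi g0 [gdrv gval].
have dg : differentiable gamma 0 by exact/derivable1_diffP.
have dphig : differentiable phi (gamma 0) by rewrite g0.
have dc : differentiable (phi \o gamma) 0 by exact: differentiable_comp.
split; first exact/derivable1_diffP.
by rewrite deriveE// diff_comp//= -(deriveE _ dg) gval g0.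
Qed.

Lemma sphere_diffE (R : realType) (E H : completeNormedModType R)
    (dotH : {dot H for idfun}) (j : {linear E -> H}) (mu : R) (phi : E -> R)
    (u v : E) :
  hilbert_embedding dotH j -> 0 < mu -> differentiable phi u ->
  sphere (pullback dotH j) mu u -> tangent (pullback dotH j) u v ->
  sphere_diff (pullback dotH j) mu phi u v = 'd phi u v.
Proof.
rewrite /sphere /tangent /pullback /= => -[j_inj _ _] mu0 dphi uS uv.
apply: get_unique => [|d [gamma [_ g0 dg [_ <-]]]]; last first.
  by have [_ ->] := is_derive_along dphi g0 dg.
have vu : dotH (j v) (j u) = 0.
  by rewrite (hermitian_subproof (j v) (j u)) /= uv mulr0.
pose a := Num.sqrt (dotH (j v) (j v) / mu).
pose gamma (t : R) : E := cos (a * t) *: u + (sin (a * t) / a) *: v.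
have vv0 : 0 <= dotH (j v) (j v).
  have [->|jv0] := eqVneq (j v) 0; first by rewrite linear0l.
  exact/ltW/neq0_dnorm_gt0.
have a2 : a ^+ 2 * mu = dotH (j v) (j v).
  by rewrite sqr_sqrtr ?divr_ge0 ?(ltW mu0)// divfK// gt_eqF.
have a0v : a = 0 -> v = 0.
  move=> a0; apply: j_inj; rewrite linear0; apply/eqP/negPn/negP => jv0.
  have : 0 < dotH (j v) (j v) by exact: neq0_dnorm_gt0.
  by rewrite -a2 a0 expr0n mul0r ltxx.
have g0 : gamma 0 = u by rewrite /gamma mulr0 cos0 sin0 mul0r scale0r scale1r addr0.
have dg : is_derive (0 : R) 1 gamma v.
  have da : is_derive (0 : R) 1 ( *%R a) a.
    have := is_deriveZ a (is_derive_id (0 : R) (1 : R)).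
    by rewrite [a *: 1]mulr1.
  have dcos := @is_derive1_comp R cos _ 0 _ _ (is_derive_cos _) da.
  have dsin := @is_derive1_comp R sin _ 0 _ _ (is_derive_sin _) da.
  rewrite mulr0 sin0 oppr0 mul0r in dcos.
  rewrite mulr0 cos0 mul1r in dsin.
  have dscale (k : R -> R) dk (w : E) : is_derive (0 : R) 1 k dk ->
      is_derive (0 : R) 1 (fun t => k t *: w) (dk *: w).
    move=> [/derivable1_diffP dk1 dk2].
    have dkw := differentiableZl w dk1.
    split; first exact/derivable1_diffP.
    by rewrite (deriveE _ dkw) (diffZl w dk1) -(deriveE _ dk1) dk2.
  have dsina := is_deriveZ a^-1 dsin.
  have := is_deriveD (dscale _ _ u dcos) (dscale _ _ v dsina).
  rewrite scale0r add0r.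
  suff -> : (a^-1 *: a) *: v = v.
    congr is_derive; apply/funext => t.
    by rewrite /gamma /= [sin _ / a]mulrC.
  have [/a0v ->|a0] := eqVneq a 0; first by rewrite scaler0.
  by rewrite [_ *: a]mulVf// scale1r.
exists gamma; split => //; last exact: is_derive_along dphi g0 dg.
apply: filterE => t; rewrite /sphere /=.
have -> : j (gamma t) = cos (a * t) *: j u + (sin (a * t) / a) *: j v.
  by rewrite /gamma linearD !linearZ.
have dZ x y b c : dotH (b *: x) (c *: y) = b * (c * dotH x y).
  by rewrite linearZl_LR linearZ.
have dD x y z : dotH (x + y) z = dotH x z + dotH y z by rewrite linearDl.
have dDr x y z : dotH z (x + y) = dotH z x + dotH z y by rewrite linearD.
rewrite dD !dDr !dZ uS uv vu -a2 !mulr0 addr0 add0r.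
have [/a0v v0|a0] := eqVneq a 0.
  have -> : a = 0 by rewrite /a v0 linear0 linear0l mul0r sqrtr0.
  by rewrite mul0r cos0 sin0 !mul0r addr0 !mul1r.
rewrite -[RHS]mul1r -(cos2Dsin2 (a * t)).
by field.
Qed.

Section HomotopicFamily.
Variables (R : realType) (E : normedModType R).

(* The library norm on row vectors is the supremum norm. *)
Definition euclid_dist n (x y : 'rV[R]_n) : R :=
  Num.sqrt (\sum_i (x 0 i - y 0 i) ^+ 2).

Definition isometric_involution n (s : 'rV[R]_n -> 'rV[R]_n) : Prop :=
  involutive s /\ forall x y, euclid_dist (s x) (s y) = euclid_dist x y.

(* Maps defined on a subset of [R^n] are represented by total functions, of
   which only the values on that subset matter. *)
Definition Z2_homotopic_family (S : set E) (n : nat) (B : set E)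
    (F : set (set E)) : Prop :=
  B `<=` S /\
  exists (s : 'rV[R]_n -> 'rV[R]_n) (D0 D : set 'rV[R]_n) (eta0 : 'rV[R]_n -> E),
    [/\ isometric_involution s,
        [/\ compact D0, compact D & D0 `<=` D],
        [/\ s @` D = D, s @` D0 = D0 & [set x | D x /\ s x = x] = set0],
        [/\ {within D0, continuous eta0}, eta0 @` D0 `<=` B
          & forall x, D0 x -> eta0 (s x) = - eta0 x]
      & F = [set A | A `<=` S /\ exists f : 'rV[R]_n -> E,
              [/\ A = f @` D, {within D, continuous f}, f @` D `<=` S,
                  forall x, D x -> f (s x) = - f x
                & forall x, D0 x -> f x = eta0 x]]].

(* This is [max_A phi] when [phi] attains its maximum on [A], as it does on a
   nonempty compact [A]; the value is [-oo] on the empty set. *)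
Definition sup_on (phi : E -> R) (A : set E) : \bar R :=
  ereal_sup [set (phi u)%:E | u in A].

Definition minimax (phi : E -> R) (F : set (set E)) : \bar R :=
  ereal_inf [set sup_on phi A | A in F].

End HomotopicFamily.

(* Main.v *)
Require Import Defs.
From mathcomp Require Import all_boot all_order all_algebra.
From mathcomp Require Import all_classical all_reals all_analysis.
From mathcomp Require Import ring lra.

Set Implicit Arguments.
Unset Strict Implicit.
Unset Printing Implicit Defensive.
Import Order.TTheory GRing.Theory Num.Theory.
Import numFieldNormedType.Exports.

Local Open Scope classical_set_scope.
Local Open Scope ring_scope.

(** Suppose that for some small [eps] no point of the high part of [A = f(D)]
    is good together with its opposite, and write [beta = eps `^ alpha1].  Every
    high point [u] then has, at [u] or at [- u], either a tangent direction of
    slope below [- 3 beta], or more than [n] independent tangent directions on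
    whose span [D2], compared with the square of the norm, is
    below [- beta].  The map [f] is deformed, equivariantly and without
    touching its values on [D0], into a map whose image lies below
    [c - eps / 2]; this contradicts the definition of [c].

    The deformation is a finite sequence of steps.  A step moves a point [v]
    of the sphere along a vector [h] of its tangent space and renormalizes:
    [sphere_step v h = sqrt (1 - q h h / mu) v + h].  Freezing the Lagrange
    multiplier at a nearby point [u] of descent makes the second order term of
    [phi] along the step equal to [D2] at [u], up to an error controlled by the
    Hoelder condition ([local_estimate]).  So a step of length [s] along a unit
    vector on which [D2] is below [- beta] lowers [phi] by about
    [beta s ^ 2 / 2], provided that its first order term is not positive.

    Making the first order term nonpositive for all points of [D] at once, by
    a continuous choice of directions, is where the dimension enters.  On [n + 1]
    independent directions the differential is a continuous map from a compact
    part of R^n to R^(n + 1).  After a small perturbation it has no zero, since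
    a Lipschitz image of R^n is too thin to contain a ball of R^(n + 1)
    ([lipschitz_image_misses], by counting the cells of two grids); the
    opposite of the perturbed map, normalized, is the required section
    ([unit_section]).

    Steps are localized by hat functions on a grid of R^n ([grid_cover]).  A
    point and its image by the involution meet at most [2 * 2 ^ n] of them, a
    bound that does not depend on the mesh, so the points stay within a fixed
    multiple of the step length [t] from where they started and the local
    estimates remain available.
    Equivariance is preserved because the involution moves every point of [D]
    further than the mesh: a step near [x] can be mirrored near its image
    without interference ([deformation_step]).  Each high point is moved by a
    full step at least once, and the choice [t = eps `^ (1 / (alpha + 2))] makes
    the gain [beta t ^ 2 / 4] larger than [3 eps] while the error [t `^ alpha]
    stays small with respect to [beta] ([step_scales]). *)

(** * Compactness and Lipschitz images *)

Section Coordinates.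
Variables (R : realType) (n : nat).
Implicit Types (x y : 'rV[R]_n) (D : set 'rV[R]_n).

Lemma normrV_le x (a : R) : 0 <= a -> (`|x| <= a) <-> (forall i, `|x 0 i| <= a).
Proof.
move=> a0; split=> [xa i|xa].
  apply: le_trans xa; rewrite [leRHS]mx_normrE.
  by apply: le_trans (le_bigmax _ _ (0, i)) => /=.
rewrite [leLHS]mx_normrE; apply/bigmax_leP; split => // -[k i] _ /=.
by rewrite (ord1 k).
Qed.

Lemma coord_le_norm x i : `|x 0 i| <= `|x|.
Proof. exact: (normrV_le x (normr_ge0 x)).1. Qed.

End Coordinates.

Lemma compact_coord_bounded (R : realType) (n : nat) (D : set 'rV[R]_n) :
  compact D -> exists2 M : R, 0 < M & forall x i, D x -> `|x 0 i| < M.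
Proof.
move=> /compact_bounded[M [_ HM]]; exists (`|M| + 2); first by rewrite ltr_wpDl.
move=> x i Dx; apply: le_lt_trans (coord_le_norm x i) _.
apply: (@le_lt_trans _ _ (`|M| + 1)); last lra.
by apply: (HM (`|M| + 1)) => //; have := ler_norm M; lra.
Qed.

(** The Lebesgue number lemma, with a relation in place of an open cover. *)
Lemma compact_near_diagonal (R : realType) (V : normedModType R) (D : set V)
    (P : V -> V -> Prop) : compact D ->
  (forall x, D x -> exists2 d : R, 0 < d & forall y z, D y -> D z ->
     `|x - y| < d -> `|x - z| < d -> P y z) ->
  exists2 d : R, 0 < d & forall y z, D y -> D z -> `|y - z| < d -> P y z.
Proof.
move=> /compact_near_coveringP cD PD.
have : \forall d \near (0 : R)^'+, D `<=` (fun y => forall z, D z -> D y ->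
    `|y - z| < d -> P y z).
  apply: cD => x /PD[d d0 Pd].
  exists (ball x (d / 2), [set e : R | e < d / 2]) => /=.
    by split; [apply: nbhsx_ballx|apply: nbhs_right_lt]; rewrite divr_gt0.
  move=> [y e] /= []; rewrite -ball_normE /= => xy ed z Dz Dy yz.
  by apply: Pd => //; [lra|have := ler_distD y x z; lra].
move=> H; have := filterI H (nbhs_right_gt (0 : R)).
move=> /(_ _)/filter_ex[d [Hd d0]]; exists d => // y z Dy Dz; exact: Hd.
Qed.

Section Pigeonhole.
Variables (R : realType) (n : nat).

(** Take [K ^ n.+1] grid nodes in the cube of side [kappa], and cut the cube that
    contains [D] into [(C K) ^ n] cells.  If all the nodes were values of [g],
    distinct nodes would have preimages in distinct cells; this is absurd for
    [K > C ^ n]. *)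
Lemma lipschitz_image_misses (D : set 'rV[R]_n) (M : R) (g : 'I_n.+1 -> 'rV[R]_n -> R)
    (L kappa : R) : 0 < M -> 0 < L -> 0 < kappa ->
  (forall x i, D x -> `|x 0 i| < M) ->
  (forall k x y, D x -> D y -> `|g k x - g k y| <= L * `|x - y|) ->
  exists2 p : 'I_n.+1 -> R, forall k, `|p k| <= kappa &
    forall x, D x -> exists k, g k x != p k.
Proof.
move=> M0 L0 k0 DM gL; apply: contrapT => noP.
(* [C] makes the image of a cell narrower than the gap between two nodes. *)
pose C := (Num.truncn (2 * M * L / kappa)).+1.
pose K := (C ^ n).+1; pose N := (C * K)%N.
have C0 : (0 < C)%N by [].
have N0 : (0 < N)%N by rewrite muln_gt0.
have CE : 2 * M * L / kappa < C%:R.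
  by have /truncn_itv/andP[] : 0 <= 2 * M * L / kappa by rewrite divr_ge0 ?mulr_ge0 ?ltW//; lra.
have K0 : (0 : R) < K%:R by rewrite ltr0n.
have Cr0 : (0 : R) < C%:R by rewrite ltr0n.
pose p (z : {ffun 'I_n.+1 -> 'I_K}) k : R := kappa * (z k)%:R / K%:R.
have /choice[xz xzP] (z : {ffun 'I_n.+1 -> 'I_K}) :
    exists x, D x /\ forall k, g k x = p z k.
  apply: contrapT => nx; apply: noP; exists (p z) => [k|x Dx].
    rewrite ger0_norm; last by rewrite /p divr_ge0 ?mulr_ge0 ?(ltW k0) ?ler0n.
    by rewrite ler_pdivrMr// ler_wpM2l ?(ltW k0)// ler_nat ltnW.
  apply: contrapT => nk; apply: nx; exists x; split => // k.
  by apply: contrapT => /eqP gk; apply: nk; exists k.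
pose a (x : 'rV[R]_n) i : R := (x 0 i + M) / (2 * M) * N%:R.
have aP x i : D x -> 0 <= a x i < N%:R.
  move=> /(DM x i); rewrite ltr_norml => /andP[x1 x2].
  have q : 0 <= (x 0 i + M) / (2 * M) < 1.
    by rewrite divr_ge0 ?ltr_pdivrMr; lra.
  rewrite /a; case/andP: q => q1 q2; rewrite mulr_ge0//=.
  by rewrite gtr_pMl// ltr0n.
have cellP x i : D x -> (Num.truncn (a x i) < N)%N.
  move=> /(aP x i)/andP[a0 aN]; rewrite -(ltr_nat R).
  by apply: le_lt_trans aN; case/andP: (truncn_itv a0).
pose cell (z : {ffun 'I_n.+1 -> 'I_K}) : {ffun 'I_n -> 'I_N} :=
  [ffun i => Ordinal (cellP _ i (xzP z).1)].
have cell_inj : injective cell.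
  move=> z z' /ffunP zz'.
  have [Dz gz] := xzP z; have [Dz' gz'] := xzP z'.
  have close : `|xz z - xz z'| <= 2 * M / N%:R.
    apply/normrV_le; first by rewrite divr_ge0//; lra.
    move=> i; have := zz' i; rewrite !ffunE => /(congr1 val) /= tt'.
    have /andP[/truncn_itv/andP[a1 a2] _] := aP _ i Dz.
    have /andP[/truncn_itv/andP[b1 b2] _] := aP _ i Dz'.
    rewrite !mxE.
    have -> : xz z 0 i - xz z' 0 i = (a (xz z) i - a (xz z') i) * (2 * M / N%:R).
      rewrite /a; field; apply/andP; split; first by rewrite pnatr_eq0 -lt0n.
      exact: lt0r_neq0.
    rewrite normrM (ger0_norm (_ : 0 <= 2 * M / N%:R)); last by rewrite divr_ge0//; lra.
    rewrite ler_piMl//; first by rewrite divr_ge0//; lra.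
    rewrite tt' in a1 a2; rewrite -natr1 in a2; rewrite -natr1 in b2.
    by rewrite ler_norml; apply/andP; split; lra.
  apply/ffunP => k; apply/val_inj/eqP.
  have := gL k _ _ Dz Dz'; rewrite gz gz' /p => pp.
  have {pp}: kappa / K%:R * `|(z k)%:R - (z' k)%:R| <= L * (2 * M / N%:R).
    apply: le_trans (le_trans pp _); last by rewrite ler_wpM2l// ltW.
    have -> : kappa * (z k)%:R / K%:R - kappa * (z' k)%:R / K%:R =
        kappa / K%:R * ((z k)%:R - (z' k)%:R) by field; exact: lt0r_neq0.
    by rewrite normrM ger0_norm// divr_ge0 ?ltW.
  have NE : (N%:R : R) = C%:R * K%:R by rewrite natrM.
  rewrite NE => pp.
  have lt1 : `|(z k)%:R - (z' k)%:R| < 1 :> R.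
    rewrite ltr_pdivrMr// in CE.
    have e1 : L * (2 * M / (C%:R * K%:R)) = (2 * M * L / C%:R) / K%:R.
      by field; rewrite !lt0r_neq0.
    rewrite e1 mulrAC ler_pM2r ?invr_gt0// in pp.
    rewrite ler_pdivlMr// in pp.
    rewrite -(ltr_pM2l k0) -(ltr_pM2r Cr0); apply: le_lt_trans pp _; lra.
  rewrite ltr_norml in lt1; case/andP: lt1 => l1 l2.
  by rewrite eqn_leq; apply/andP; split; rewrite -ltnS -(ltr_nat R) -natr1; lra.
have := leq_card cell cell_inj.
rewrite !card_ffun !card_ord /N expnMn expnS leq_pmul2r ?expn_gt0//.
by rewrite /K ltnn.
Qed.

End Pigeonhole.

Lemma within_continuousP (R : realType) (V W : normedModType R) (D : set V)
    (f : V -> W) : {within D, continuous f} <->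
  forall x (e : R), D x -> 0 < e -> exists2 d : R, 0 < d &
    forall y, D y -> `|x - y| < d -> `|f x - f y| < e.
Proof.
split=> [/subspace_continuousP Df x e Dx e0|Df].
  have /cvgrPdist_lt/(_ e e0) := Df x Dx.
  rewrite near_withinE => /nbhs_ballP[d /= d0 xd]; exists d => // y Dy xy.
  by apply: xd => //; rewrite -ball_normE.
apply/subspace_continuousP => x Dx; apply/cvgrPdist_lt => e e0.
have [d d0 xd] := Df x e Dx e0.
rewrite near_withinE; apply/nbhs_ballP; exists d => //= y.
by rewrite -ball_normE /= => xy Dy; exact: xd.
Qed.

Lemma compact_unif_continuous (R : realType) (V W : normedModType R) (D : set V)
    (f : V -> W) (e : R) : compact D -> {within D, continuous f} -> 0 < e ->
  exists2 d : R, 0 < d &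
    forall y z, D y -> D z -> `|y - z| < d -> `|f y - f z| < e.
Proof.
move=> cD /within_continuousP Df e0; apply: compact_near_diagonal => // x Dx.
have [|d d0 xd] := Df x (e / 2) Dx; first by rewrite divr_gt0.
exists d => // y z Dy Dz xy xz.
have := ler_distD (f x) (f y) (f z); rewrite (distrC (f y) (f x)).
have := xd y Dy xy; have := xd z Dz xz; lra.
Qed.

(** The infimal convolution of [m] with a steep cone is Lipschitz, and it differs
    from [m] by at most [e] once the cone rises by the oscillation of [m] over
    the distance [d] of uniform continuity. *)
Lemma lipschitz_approx (R : realType) (V : normedModType R) (D : set V)
    (m : V -> R) (e : R) : compact D -> {within D, continuous m} -> 0 < e ->
  exists2 L : R, 0 < L & exists m' : V -> R,
    (forall x y, D x -> D y -> `|m' x - m' y| <= L * `|x - y|) /\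
    (forall x, D x -> `|m' x - m x| <= e).
Proof.
move=> cD Dm e0.
have [d d0 md] := compact_unif_continuous cD Dm e0.
have [M M0 mM] : exists2 M : R, 0 < M & forall x, D x -> `|m x| <= M.
  have /compact_bounded[M [_ HM]] := continuous_compact Dm cD.
  exists (`|M| + 1); first by rewrite ltr_wpDl.
  by move=> x Dx; apply: (HM (`|M| + 1)); [have := ler_norm M; lra|exists x].
pose L := 2 * M / d; have L0 : 0 < L by rewrite divr_gt0 ?mulr_gt0.
pose P x := [set m y + L * `|x - y| | y in D].
have Plb x : lbound (P x) (- M).
  move=> _ [y Dy <-]; have := mM y Dy; rewrite ler_norml => /andP[+ _].
  have : 0 <= L * `|x - y| by rewrite mulr_ge0 ?(ltW L0).
  lra.
have infle x y : D x -> D y -> inf (P x) <= m y + L * `|x - y|.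
  by move=> Dx Dy; apply: ge_inf; [exists (- M)|exists y].
have leinf x a : D x -> (forall y, D y -> a <= m y + L * `|x - y|) -> a <= inf (P x).
  move=> Dx H; apply: lb_le_inf; first by exists (m x + L * `|x - x|); exists x.
  by move=> _ [y Dy <-]; exact: H.
have half x y : D x -> D y -> inf (P x) <= inf (P y) + L * `|x - y|.
  move=> Dx Dy; rewrite -lerBlDr; apply: leinf => // z Dz; rewrite lerBlDr.
  apply: le_trans (infle x z Dx Dz) _; rewrite -addrA lerD2l -mulrDr.
  by rewrite ler_pM2l// [leRHS]addrC; exact: ler_distD.
exists L => //; exists (fun x => inf (P x)); split=> [x y Dx Dy|x Dx].
  have := half _ _ Dx Dy; have := half _ _ Dy Dx; rewrite (distrC y x) ler_norml.
  by move=> ? ?; apply/andP; split; lra.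
have := infle x x Dx Dx; rewrite subrr normr0 mulr0 addr0 => h1.
have h2 : m x - e <= inf (P x).
  apply: leinf => // y Dy; have [xy|xy] := ltP `|x - y| d.
    have := md x y Dx Dy xy; rewrite ltr_norml => /andP[_].
    have : 0 <= L * `|x - y| by rewrite mulr_ge0 ?(ltW L0).
    lra.
  have : 2 * M <= L * `|x - y|.
    by rewrite -(ler_pM2l L0) /L in xy; rewrite (divfK (lt0r_neq0 d0)) in xy.
  have := mM x Dx; have := mM y Dy; rewrite !ler_norml => /andP[? ?] /andP[? ?]; lra.
by rewrite ler_norml; apply/andP; split; lra.
Qed.

(** Shifting a Lipschitz approximation of [m] by a small value that it misses
    removes its zeros: the source has one dimension less than the target. *)
Lemma nonvanishing_approx (R : realType) (n : nat) (D : set 'rV[R]_n)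
    (m : 'I_n.+1 -> 'rV[R]_n -> R) (e : R) : compact D ->
  (forall k, {within D, continuous (m k)}) -> 0 < e ->
  exists m' : 'I_n.+1 -> 'rV[R]_n -> R,
    [/\ forall k, {within D, continuous (m' k)},
        forall k x, D x -> `|m' k x - m k x| <= e
      & forall x, D x -> exists k, m' k x != 0].
Proof.
move=> cD Dm e0; have e20 : 0 < e / 2 by rewrite divr_gt0.
have /choice[Lg LgP] (k : 'I_n.+1) : exists Lg : R * ('rV[R]_n -> R),
    [/\ 0 < Lg.1, forall x y, D x -> D y -> `|Lg.2 x - Lg.2 y| <= Lg.1 * `|x - y|
      & forall x, D x -> `|Lg.2 x - m k x| <= e / 2].
  by have [L L0 [g [gL gm]]] := lipschitz_approx cD (Dm k) e20; exists (L, g).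
pose L := \big[Num.max/1]_k (Lg k).1.
have L0 : 0 < L by apply: lt_le_trans (bigmax_ge_id _ _ _ _); exact: ltr01.
have LgL k : (Lg k).1 <= L by exact: le_bigmax.
have gL k x y : D x -> D y -> `|(Lg k).2 x - (Lg k).2 y| <= L * `|x - y|.
  by move=> Dx Dy; have [_ + _] := LgP k; move=> /(_ x y Dx Dy)/le_trans; apply; rewrite ler_wpM2r.
have [M M0 DM] := compact_coord_bounded cD.
have [p pe pg] := lipschitz_image_misses M0 L0 e20 DM gL.
exists (fun k x => (Lg k).2 x - p k); split=> [k|k x Dx|x Dx].
- apply/within_continuousP => x d Dx d0; exists (d / L); first exact: divr_gt0.
  move=> y Dy xy; rewrite opprB addrA subrK.
  by apply: le_lt_trans (gL k x y Dx Dy) _; rewrite -ltr_pdivlMl// mulrC.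
- have [_ _ /(_ x Dx)] := LgP k; have := pe k; rewrite !ler_norml => /andP[? ?] /andP[? ?].
  by apply/andP; split; lra.
- by have [k gk] := pg x Dx; exists k; rewrite subr_eq0.
Qed.

(** * Unit sections of a family of subspaces *)

(** A maximal independent family with at most [n] members would be a basis. *)
Lemma independent_family (R : realType) (V : lmodType R) (W : {pred V}) (n : nat) :
  ~ dim_le W n ->
  exists b : 'I_n.+1 -> V, (forall i, b i \in W) /\
    forall a : 'I_n.+1 -> R, \sum_i a i *: b i = 0 -> forall i, a i = 0.
Proof.
move=> ndim.
suff H k : (k <= n.+1)%N -> exists b : 'I_k -> V, (forall i, b i \in W) /\
    forall a : 'I_k -> R, \sum_i a i *: b i = 0 -> forall i, a i = 0 by exact: H.
elim: k => [_|k IH kn]; first by exists (fun=> 0); split=> [[]//|a _ []].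
have [b [bW b_free]] := IH (ltnW kn).
have [w wW wb] : exists2 w, w \in W & forall a : 'I_k -> R, w <> \sum_i a i *: b i.
  apply: contrapT => nw; apply: ndim; exists k => //; exists b; split => // w wW.
  by apply: contrapT => na; apply: nw; exists w => // a wa; apply: na; exists a.
exists (fun i => if unlift ord_max i is Some j then b j else w); split=> [i|a].
  by case: unliftP.
rewrite big_ord_recr /= unlift_none.
have -> : \sum_(i < k) a (widen_ord (leqnSn k) i) *:
    (if unlift ord_max (widen_ord (leqnSn k) i) is Some j then b j else w) =
    \sum_(i < k) a (lift ord_max i) *: b i.
  apply: eq_bigr => i _.
  have -> : widen_ord (leqnSn k) i = lift ord_max i by apply: val_inj; exact: esym (lift_max i).
  by rewrite liftK.
have [a0 sum0|a0 sum0] := eqVneq (a ord_max) 0.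
  move: sum0; rewrite a0 scale0r addr0 => /b_free ab i.
  by case: (unliftP ord_max i) => [j ->|->].
have [] := wb (fun i => - (a ord_max)^-1 * a (lift ord_max i)).
under eq_bigr do rewrite -scalerA.
rewrite -scaler_sumr; move/eqP: sum0; rewrite addr_eq0 => /eqP ->.
by rewrite scaleNr scalerN opprK scalerA mulVf// scale1r.
Qed.

Lemma cvg_lincomb (R : realType) (V : normedModType R) (T : Type)
    (F : set_system T) (k : nat) (b : 'I_k -> V) (a : 'I_k -> T -> R)
    (l : 'I_k -> R) : Filter F -> (forall i, a i x @[x --> F] --> l i) ->
  \sum_i a i x *: b i @[x --> F] --> \sum_i l i *: b i.
Proof.
move=> FF al.
have op_cont : continuous (fun z : V * V => z.1 + z.2) by exact: add_continuous.
apply: (@cvg_big V 'I_k +%R 0 xpredT op_cont _ _ _ (fun i x => a i x *: b i)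
  (fun i => l i *: b i)) => i _.
by apply: cvgZr_tmp.
Qed.

(** The norm of the combination has a positive minimum on the unit sphere of
    coefficients, which is compact. *)
Lemma independent_lower_bound (R : realType) (V : normedModType R) (k : nat)
    (b : 'I_k -> V) :
  (forall a : 'I_k -> R, \sum_i a i *: b i = 0 -> forall i, a i = 0) ->
  exists2 d : R, 0 < d &
    forall (a : 'I_k -> R) i, d * `|a i| <= `|\sum_i a i *: b i|.
Proof.
move=> b_free; pose N (a : 'rV[R]_k) : R := `|\sum_i a 0 i *: b i|.
pose A : set 'rV[R]_k := [set a | `|a| = 1].
have Ncont : continuous N.
  move=> a; apply: (@cvg_norm _ V _ (nbhs a) _ (fun v => \sum_i v 0 i *: b i)
    (\sum_i a 0 i *: b i)).
  apply: cvg_lincomb => i; exact: coord_continuous.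
have cA : compact A.
  apply: bounded_closed_compact.
    by exists 1; split => // x x1 a /= a1; rewrite -[leLHS]/(`|a|) a1 ltW.
  apply: (@closed_comp _ _ (fun a : 'rV[R]_k => `|a|) [set x : R | x = 1]).
    by move=> a _; exact: norm_continuous.
  exact: closed_eq.
have [d d0 dA] : exists2 d : R, 0 < d & forall a, A a -> d <= N a.
  have [A0|/set0P A0] := eqVneq A set0; first by exists 1 => // a; rewrite A0.
  have [c Ac cmin] := compact_EVT_min A0 cA (continuous_subspaceT Ncont).
  exists (N c); last by move=> a Aa; apply: cmin; rewrite inE.
  rewrite lt_neqAle normr_ge0 andbT eq_sym normr_eq0; apply/eqP => /b_free c0.
  have : c = 0 by apply/rowP => i; rewrite c0 mxE.
  move: Ac; rewrite inE /A /= => + c00; rewrite c00 normr0 => /eqP.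
  by rewrite eq_sym oner_eq0.
exists d => // a i; pose v : 'rV[R]_k := \row_j a j.
have [v0|v0] := eqVneq v 0.
  have -> : a i = 0 by have := congr1 (fun u : 'rV[R]_k => u 0 i) v0; rewrite !mxE.
  by rewrite normr0 mulr0.
have v_gt0 : 0 < `|v| by rewrite normr_gt0.
have : d <= N (`|v|^-1 *: v).
  by apply: dA; rewrite /A /= normrZ ger0_norm ?invr_ge0// mulVf// lt0r_neq0.
have -> : N (`|v|^-1 *: v) = `|v|^-1 * `|\sum_i a i *: b i|.
  rewrite /N; under eq_bigr do rewrite !mxE -scalerA.
  by rewrite -scaler_sumr normrZ ger0_norm ?invr_ge0.
rewrite mulrC ler_pdivlMr// => dv; apply: le_trans dv; rewrite ler_pM2l//.
by have := coord_le_norm v i; rewrite mxE.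
Qed.

(** The combination with coefficients [- m i x], for a nonvanishing [m] close to
    [l], is nonzero by independence.  Normalized, it pairs with [l] into a
    negative multiple of [\sum_i m i x ^+ 2], up to an error that can be made
    small. *)
Lemma unit_section (R : realType) (n : nat) (V : normedModType R)
    (D : set 'rV[R]_n) (b : 'I_n.+1 -> V) (l : 'I_n.+1 -> 'rV[R]_n -> R) (e : R) :
  compact D ->
  (forall a : 'I_n.+1 -> R, \sum_i a i *: b i = 0 -> forall i, a i = 0) ->
  (forall i, {within D, continuous (l i)}) -> 0 < e ->
  exists a : 'I_n.+1 -> 'rV[R]_n -> R,
    [/\ forall i, {within D, continuous (a i)},
        forall x, D x -> `|\sum_i a i x *: b i| = 1
      & forall x, D x -> \sum_i a i x * l i x <= e].
Proof.
move=> cD b_free lD e0.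
have [d d0 db] := independent_lower_bound b_free.
pose e' := e * d / n.+1%:R.
have e'0 : 0 < e' by rewrite divr_gt0// mulr_gt0.
have [m [mD ml m0]] := nonvanishing_approx cD lD e'0.
pose N x := `|\sum_i m i x *: b i|.
have N0 x : D x -> 0 < N x.
  move=> /m0[k mk]; rewrite lt_neqAle normr_ge0 andbT eq_sym normr_eq0.
  by apply/negP => /eqP /b_free/(_ k)/eqP; exact/negP.
exists (fun i x => - (m i x / N x)); split=> [i|x Dx|x Dx].
- apply/subspace_continuousP => x Dx; apply: cvgN; apply: cvgM.
    by have /subspace_continuousP := mD i; apply.
  apply: cvgV; first by rewrite lt0r_neq0// N0.
  apply: cvg_norm; apply: (@cvg_lincomb R V _ (within D (nbhs x)) _ b m) => k.
  by have /subspace_continuousP := mD k; apply.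
- have -> : \sum_i - (m i x / N x) *: b i = - (N x)^-1 *: \sum_i m i x *: b i.
    by rewrite scaler_sumr; apply: eq_bigr => i _; rewrite scalerA; congr (_ *: _); ring.
  rewrite normrZ normrN ger0_norm ?invr_ge0 ?(ltW (N0 x Dx))//.
  by apply: mulVf; exact/lt0r_neq0/N0.
- have -> : e = \sum_(i < n.+1) e / n.+1%:R.
    by rewrite sumr_const card_ord -[RHS]mulr_natr divfK// pnatr_eq0.
  apply: ler_sum => i _.
  have h1 : d * `|m i x| <= N x := db (fun i => m i x) i.
  have h2 := ml i x Dx; have Nx := N0 x Dx.
  have h3 : - (m i x * l i x) <= `|m i x| * e'.
    have -> : - (m i x * l i x) = m i x * (m i x - l i x) - m i x ^+ 2 by ring.
    apply: (@le_trans _ _ (m i x * (m i x - l i x))); first by rewrite gerBl sqr_ge0.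
    by apply: le_trans (ler_norm _) _; rewrite normrM ler_wpM2l.
  have -> : - (m i x / N x) * l i x = - (m i x * l i x) / N x by ring.
  rewrite ler_pdivrMr//; apply: le_trans h3 _.
  have -> : `|m i x| * e' = e / n.+1%:R * (d * `|m i x|) by rewrite /e'; ring.
  by rewrite ler_wpM2l// divr_ge0// ltW.
Qed.

(** * Second order upper bounds *)

Lemma taylor2_upper (R : realType) (G G1 G2 : R -> R) (b : R) :
  (forall s : R, is_derive s 1 G (G1 s)) ->
  (forall s : R, is_derive s 1 G1 (G2 s)) ->
  (forall s, 0 <= s <= 1 -> G2 s <= b) ->
  G 1 <= G 0 + G1 0 + b / 2.
Proof.
move=> dG dG1 G2b.
have cont (f df : R -> R) (i : interval R) : (forall s : R, is_derive s 1 f (df s)) ->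
    {within [set` i], continuous f}.
  by move=> df'; apply: derivable_within_continuous => x _; have [] := df' x.
have G1b s : 0 <= s <= 1 -> G1 s <= G1 0 + b * s.
  case/andP => s0 s1; have [|t] := MVT_segment s0 (fun x _ => dG1 x).
    exact: cont dG1.
  rewrite in_itv /= subr0 => /andP[t0 ts] e.
  have : G2 t <= b by apply: G2b; rewrite t0 (le_trans ts).
  by move=> /(ler_wpM2r s0); lra.
pose K := G - (G1 0 *: id) - ((b / 2) *: (id ^+ 2)) : R -> R.
have dK (s : R) : is_derive s 1 K (G1 s - G1 0 - b * s).
  have h1 := is_deriveZ (G1 0) (is_derive_id s (1 : R)).
  have h2 := is_deriveZ (b / 2) (is_deriveX 2 (is_derive_id s (1 : R))).
  apply: is_derive_eq (is_deriveB (is_deriveB (dG s) h1) h2) _.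
  rewrite [G1 0 *: 1]mulr1; congr (_ - _).
  by rewrite [_ *: 1]mulr1 [LHS]mulrCA expr1; field.
have [|t] := MVT_segment ler01 (fun x _ => dK x); first exact: cont dK.
rewrite in_itv /= => /G1b Kt.
have -> : K 1 = G 1 - G1 0 * 1 - b / 2 * 1 ^+ 2 by [].
have -> : K 0 = G 0 - G1 0 * 0 - b / 2 * 0 ^+ 2 by [].
rewrite expr1n expr0n /=; lra.
Qed.

Section OperatorNormBounds.
Variables (R : realType) (E : normedModType R).

Lemma dual_norm_le (l : E -> R) (K : R) v :
  (forall a v, l (a *: v) = a * l v) -> (dual_norm setT l <= K%:E)%E ->
  `|l v| <= K * `|v|.
Proof.
move=> lZ lK; have [->|v0] := eqVneq v 0.
  by rewrite -(scale0r (0 : E)) lZ mul0r normr0 scale0r normr0 mulr0.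
have v_gt0 : 0 < `|v| by rewrite normr_gt0.
have : (`|l (`|v|^-1 *: v)|%:E <= K%:E)%E.
  apply: le_trans lK; apply: ereal_sup_ubound; exists (`|v|^-1 *: v) => //; split => //.
  by rewrite normrZ ger0_norm ?invr_ge0// mulVf// lt0r_neq0.
by rewrite lee_fin lZ normrM ger0_norm ?invr_ge0// mulrC ler_pdivrMr.
Qed.

Lemma bilin_norm_le (b : E -> E -> R) (K : R) u v :
  (forall a u v, b (a *: u) v = a * b u v) ->
  (forall a u v, b u (a *: v) = a * b u v) -> (bilin_norm b <= K%:E)%E ->
  `|b u v| <= K * `|u| * `|v|.
Proof.
move=> bZl bZr bK; have [->|u0] := eqVneq u 0.
  by rewrite -(scale0r (0 : E)) bZl mul0r normr0 scale0r normr0 mulr0 mul0r.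
have u_gt0 : 0 < `|u| by rewrite normr_gt0.
have : (dual_norm setT (b (`|u|^-1 *: u)) <= K%:E)%E.
  apply: le_trans bK; apply: ereal_sup_ubound; exists (`|u|^-1 *: u) => //=.
  by rewrite normrZ ger0_norm ?invr_ge0// mulVf// lt0r_neq0.
move=> /(dual_norm_le v (fun a w => bZr a _ w)); rewrite bZl normrM.
rewrite (ger0_norm (_ : 0 <= `|u|^-1)) ?invr_ge0//.
have -> : `|u|^-1 * `|b u v| <= K * `|v| = (`|b u v| <= K * `|u| * `|v|).
  by rewrite mulrC ler_pdivrMr// mulrAC.
by [].
Qed.

End OperatorNormBounds.

Section AlongSegments.
Variables (R : realType) (E : normedModType R) (phi : E -> R).

Lemma diff_valD u v w : 'd phi u (v + w) = 'd phi u v + 'd phi u w.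
Proof. by rewrite linearD. Qed.
Lemma diff_valZ u a v : 'd phi u (a *: v) = a * 'd phi u v.
Proof. by rewrite linearZ. Qed.
Lemma diff_valN u v : 'd phi u (- v) = - 'd phi u v.
Proof. by rewrite linearN. Qed.

Hypothesis phiC2 : C2 phi.

Lemma hess_linearl u v : linear_for *%R ((hess phi u)^~ v).
Proof. by have [_ /(_ u)[[+ _] _ _] _] := phiC2; apply. Qed.
Lemma hess_linearr u v : linear_for *%R (hess phi u v).
Proof. by have [_ /(_ u)[[_ +] _ _] _] := phiC2; apply. Qed.

Lemma hess0l u v : hess phi u 0 v = 0.
Proof. have := hess_linearl u v (-1) 0 0. rewrite /= scaler0 addr0; lra. Qed.
Lemma hess0r u v : hess phi u v 0 = 0.
Proof. have := hess_linearr u v (-1) 0 0. rewrite /= scaler0 addr0; lra. Qed.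
Lemma hessDl u v w x : hess phi u (v + w) x = hess phi u v x + hess phi u w x.
Proof. by have := hess_linearl u x 1 v w; rewrite scale1r mul1r. Qed.
Lemma hessDr u v w x : hess phi u x (v + w) = hess phi u x v + hess phi u x w.
Proof. by have := hess_linearr u x 1 v w; rewrite scale1r mul1r. Qed.
Lemma hessZl u a v x : hess phi u (a *: v) x = a * hess phi u v x.
Proof. by have := hess_linearl u x a v 0; rewrite !addr0 hess0l addr0. Qed.
Lemma hessZr u a v x : hess phi u x (a *: v) = a * hess phi u x v.
Proof. by have := hess_linearr u x a v 0; rewrite !addr0 hess0r addr0. Qed.

Lemma is_derive_segment v h (s : R) :
  is_derive s 1 (fun s => phi (v + s *: h)) ('d phi (v + s *: h) h).
Proof.
have [dphi _ _] := phiC2.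
have dl : is_derive s 1 (fun t : R => v + t *: h) h.
  have [/derivable1_diffP did idE] := is_derive_id s (1 : R).
  have dZ : is_derive s 1 (fun t : R => t *: h) h.
    have dh := differentiableZl h did.
    split; first exact/derivable1_diffP.
    by rewrite (deriveE _ dh) (diffZl h did) -(deriveE _ did) idE scale1r.
  by have := is_deriveD (is_derive_cst v s (1 : R)) dZ; rewrite add0r.
have [gdrv gval] := dl.
have dg : differentiable (fun t : R => v + t *: h) s by exact/derivable1_diffP.
have dphig : differentiable phi ((fun t : R => v + t *: h) s) by exact: dphi.
have dc := differentiable_comp dg dphig.
split; first exact/derivable1_diffP.
by rewrite (deriveE _ dc) diff_comp//= -(deriveE _ dg) gval.
Qed.

Lemma is_derive_diff_segment v h (s : R) :
  is_derive s 1 (fun s => 'd phi (v + s *: h) h) (hess phi (v + s *: h) h h).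
Proof.
have [_ hphi _] := phiC2; have [_ _ near_hess] := hphi (v + s *: h).
pose f (s : R) := 'd phi (v + s *: h) h.
suff H : t^-1 *: ((f \o shift s) (t *: 1) - f s) @[t --> 0^'] -->
    (hess phi (v + s *: h) h h : R).
  by split; [apply/cvg_ex; eexists; exact: H|exact: cvg_lim].
apply/cvgrPdist_le => e e0.
pose e1 := e / (`|h| + 1) ^+ 2.
have e10 : 0 < e1 by rewrite divr_gt0// exprn_gt0// ltr_wpDl.
have /nbhs_ballP[d /= d0 dP] := near_hess e1 e10.
apply/nbhs_ballP; exists (d / (`|h| + 1)); first by rewrite /= divr_gt0// ltr_wpDl.
move=> t /=; rewrite -ball_normE /= sub0r normrN => td tn0.
have th : ball 0 d (t *: h).
  rewrite -ball_normE /= sub0r normrN normrZ.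
  apply: le_lt_trans (_ : `|t| * (`|h| + 1) < d).
    by rewrite ler_wpM2l// lerDl.
  by rewrite -ltr_pdivlMr// ltr_wpDl.
have := dual_norm_le h _ (dP _ th) => /(_ _).
have -> : v + s *: h + t *: h = v + (t + s) *: h.
  by rewrite scalerDl addrCA addrA addrAC addrC addrAC addrA.
move=> /(_ _) => H.
have {}H : `|'d phi (v + (t + s) *: h) h - 'd phi (v + s *: h) h
    - hess phi (v + s *: h) (t *: h) h| <= e1 * `|t *: h| * `|h|.
  apply: H => a w; rewrite !diff_valZ hessZr; ring.
have -> : hess phi (v + s *: h) h h - t^-1 *: ((f \o shift s) (t *: 1) - f s) =
   - t^-1 * ('d phi (v + (t + s) *: h) h - 'd phi (v + s *: h) h
    - hess phi (v + s *: h) (t *: h) h).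
  have scalerE (a c : R) : a *: c = a * c by [].
  by rewrite hessZl /f /= !scalerE mulr1; field; exact: tn0.
rewrite normrM normrN normfV ler_pdivrMl ?normr_gt0//.
apply: le_trans H _; rewrite normrZ.
have -> : e1 * (`|t| * `|h|) * `|h| = `|t| * (e1 * `|h| ^+ 2) by ring.
rewrite ler_pM2l ?normr_gt0// /e1 mulrAC ler_pdivrMr ?exprn_gt0 ?ltr_wpDl//.
by rewrite ler_pM2l// ler_sqr ?nnegrE ?addr_ge0// lerDl.
Qed.

Lemma second_order_upper v h (b : R) :
  (forall s, 0 <= s <= 1 -> hess phi (v + s *: h) h h <= b) ->
  phi (v + h) <= phi v + 'd phi v h + b / 2.
Proof.
move=> hb; have := taylor2_upper (is_derive_segment v h) (is_derive_diff_segment v h) hb.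
by rewrite scale1r scale0r addr0.
Qed.

End AlongSegments.

(** * Steps on the sphere *)

(** What the estimates retain of the inner product of the larger space. *)
Definition weak_inner (R : realType) (E : normedModType R) (q : E -> E -> R) :=
  [/\ forall u v w, q (u + v) w = q u w + q v w,
      forall a u v, q (a *: u) v = a * q u v,
      forall u v, q u v = q v u,
      forall u, 0 <= q u u
    & forall u v, `|q u v| <= `|u| * `|v|].

(** For [v] on the sphere, the [q]-orthogonal projection on its tangent space. *)
Definition tangent_proj (R : realType) (E : normedModType R) (q : E -> E -> R)
    (mu : R) (v w : E) : E := w - (q v w / mu) *: v.

(** A retraction: for a short [h] tangent at [v] the result is on the sphere, and
    the radial correction is quadratic in [h], so it does not spoil the first
    order term.  It is odd in [(v, h)], which is what equivariance requires. *)
Definition sphere_step (R : realType) (E : normedModType R) (q : E -> E -> R)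
    (mu : R) (v h : E) : E := Num.sqrt (1 - q h h / mu) *: v + h.

Lemma sqrt_one_sub_le (R : rcfType) (x : R) : 0 <= x <= 1 -> `|Num.sqrt (1 - x) - 1| <= x.
Proof.
case/andP=> x0 x1; have y0 : 0 <= 1 - x by lra.
have s0 := sqrtr_ge0 (1 - x); have s2 := sqr_sqrtr y0.
have s1 : Num.sqrt (1 - x) <= 1 by rewrite -[leRHS]sqrtr1 ler_sqrt//; lra.
have : (Num.sqrt (1 - x)) ^+ 2 <= Num.sqrt (1 - x) by rewrite expr2 ler_piMr.
rewrite s2 distrC ger0_norm; lra.
Qed.

Section SphereGeometry.
Variables (R : realType) (E : normedModType R) (q : E -> E -> R) (mu : R).
Hypotheses (qE : weak_inner q) (mu0 : 0 < mu).
Local Notation proj := (tangent_proj q mu).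
Local Notation step := (sphere_step q mu).
Local Notation S := (sphere q mu).

Lemma innerDl u v w : q (u + v) w = q u w + q v w. Proof. by case: qE. Qed.
Lemma innerZl a u v : q (a *: u) v = a * q u v. Proof. by case: qE. Qed.
Lemma innerC u v : q u v = q v u. Proof. by case: qE. Qed.
Lemma inner_ge0 u : 0 <= q u u. Proof. by case: qE. Qed.
Lemma inner_le u v : `|q u v| <= `|u| * `|v|. Proof. by case: qE. Qed.
Lemma innerDr u v w : q w (u + v) = q w u + q w v.
Proof. by rewrite innerC innerDl !(innerC w). Qed.
Lemma innerZr a u v : q u (a *: v) = a * q u v.
Proof. by rewrite innerC innerZl (innerC u). Qed.
Lemma innerNl u v : q (- u) v = - q u v.
Proof. by rewrite -scaleN1r innerZl mulN1r. Qed.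
Lemma innerNr u v : q u (- v) = - q u v.
Proof. by rewrite innerC innerNl innerC. Qed.
Lemma inner0l u : q 0 u = 0. Proof. by rewrite -(scale0r u) innerZl mul0r. Qed.
Lemma inner0r u : q u 0 = 0. Proof. by rewrite innerC inner0l. Qed.

Definition innerE := (innerDl, innerDr, innerZl, innerZr, innerNl, innerNr).

Lemma sphereN u : S u -> S (- u).
Proof. by rewrite /sphere /= innerNl innerNr opprK. Qed.

Lemma tangent_projE v w : S v -> q v (proj v w) = 0.
Proof.
rewrite /sphere /= => Sv; rewrite !innerE Sv; field.
exact: lt0r_neq0.
Qed.

Lemma tangent_projN v w : proj v (- w) = - proj v w.
Proof. by rewrite /tangent_proj innerNr mulNr scaleNr opprD. Qed.

Lemma tangent_projNl v w : proj (- v) w = proj v w.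
Proof. by rewrite /tangent_proj innerNl mulNr scaleNr scalerN opprK. Qed.

Lemma tangent_projZ v a w : proj v (a *: w) = a *: proj v w.
Proof. by rewrite /tangent_proj innerZr scalerBr scalerA mulrA. Qed.

Lemma tangent_projD v w x : proj v (w + x) = proj v w + proj v x.
Proof. by rewrite /tangent_proj innerDr mulrDl scalerDl opprD addrACA. Qed.

Lemma tangent_proj0 v : proj v 0 = 0.
Proof. by rewrite /tangent_proj inner0r mul0r scale0r subrr. Qed.

Lemma tangent_proj_sq v w : S v -> q (proj v w) (proj v w) <= q w w.
Proof.
rewrite /sphere /= => Sv; have -> : q (proj v w) (proj v w) = q w w - q v w ^+ 2 / mu.
  rewrite !innerE Sv (innerC w v); field; exact: lt0r_neq0.
by rewrite gerBl divr_ge0 ?sqr_ge0// ltW.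
Qed.

Lemma sphere_stepP v h : S v -> q v h = 0 -> q h h <= mu -> S (step v h).
Proof.
rewrite /sphere /= /sphere_step => Sv vh hmu.
rewrite !innerE Sv vh (innerC h v) vh !mulr0 addr0 add0r mulrA -expr2 sqr_sqrtr.
  by field; exact: lt0r_neq0.
by rewrite subr_ge0 ler_pdivrMr// mul1r.
Qed.

Lemma sphere_stepN v h : step (- v) (- h) = - step v h.
Proof. by rewrite /sphere_step innerNl innerNr opprK scalerN opprD. Qed.

Lemma sphere_step0 v : step v 0 = v.
Proof. by rewrite /sphere_step inner0l mul0r subr0 sqrtr1 scale1r addr0. Qed.

(** Since [w] is tangent at [u] and not at [v], projecting it at [v] costs
    [O(rho)]; the radial correction costs [O(s ^ 2)].  The two forms of the
    displacement serve the first and the second order terms. *)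
Lemma step_expansion r rho s u v w : 1 <= r -> S u -> S v ->
  `|v| <= r -> `|v - u| <= rho -> rho <= 1 -> q u w = 0 -> `|w| <= 1 ->
  0 <= s -> s <= rho -> s ^+ 2 <= mu ->
  exists k e, [/\ step v (s *: proj v w) - v = s *: proj v w + k *: v,
    `|k| <= s ^+ 2 / mu,
    step v (s *: proj v w) - v = s *: w + e &
    `|e| <= 2 * r / mu * s * rho].
Proof.
move=> r1 Su Sv vr vu rho1 uw w1 s0 srho smu.
have rho0 : 0 <= rho := le_trans s0 srho.
pose h := s *: proj v w; pose k := Num.sqrt (1 - q h h / mu) - 1.
have hh : q h h <= s ^+ 2.
  rewrite /h innerZl innerZr mulrA -expr2 ler_piMr ?sqr_ge0//.
  apply: le_trans (tangent_proj_sq w Sv) _; apply: le_trans (ler_norm _) _.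
  apply: le_trans (inner_le _ _) _; rewrite -[leRHS]mulr1.
  exact: ler_pM.
have ks : `|k| <= s ^+ 2 / mu.
  apply: le_trans (_ : q h h / mu <= _); last by rewrite ler_pM2r ?invr_gt0.
  apply: sqrt_one_sub_le; rewrite divr_ge0 ?inner_ge0 ?(ltW mu0)//= ler_pdivrMr// mul1r.
  exact: le_trans smu.
have stepE : step v h - v = h + k *: v.
  by rewrite /sphere_step /k scalerBl scale1r addrAC addrC.
exists k, (k *: v - (s * (q v w / mu)) *: v); split => //.
  rewrite stepE /h /tangent_proj scalerBr scalerA; rewrite -!addrA; congr (_ + _).
  by rewrite addrC.
have vw : `|q v w| <= rho.
  have -> : q v w = q (v - u) w by rewrite innerDl innerNl uw subr0.
  apply: le_trans (inner_le _ _) _; rewrite -[leRHS]mulr1.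
  exact: ler_pM.
have b1 : `|k *: v| <= s * rho / mu * r.
  rewrite normrZ; apply: ler_pM => //; apply: le_trans ks _.
  by rewrite ler_pM2r ?invr_gt0// expr2 ler_wpM2l.
have b2 : `|(s * (q v w / mu)) *: v| <= s * rho / mu * r.
  rewrite normrZ; apply: ler_pM => //.
  rewrite !normrM (ger0_norm s0) normfV (gtr0_norm mu0) mulrA.
  by rewrite ler_pM2r ?invr_gt0// ler_wpM2l.
apply: le_trans (ler_normB _ _) _.
have -> : 2 * r / mu * s * rho = s * rho / mu * r + s * rho / mu * r by ring.
exact: lerD.
Qed.

End SphereGeometry.

(** * The local estimate on a step *)

Section Bounds.
Variables (R : realType) (E : normedModType R) (phi : E -> R) (alpha : R).
Hypotheses (phiC2 : C2 phi) (phiH : holder_on_bounded alpha phi).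

(** All that the local estimate uses of [phi] and of its derivatives [d] and [b].
    The expansion is one-sided because only upper bounds of [phi] are sought. *)
Record bounded_derivatives (d : E -> E -> R) (b : E -> E -> E -> R) (r M : R) :
    Prop := BoundedDerivatives {
  bd_diffD : forall u v w, d u (v + w) = d u v + d u w;
  bd_diffZ : forall u a v, d u (a *: v) = a * d u v;
  bd_hessDl : forall u v w x, b u (v + w) x = b u v x + b u w x;
  bd_hessDr : forall u v w x, b u x (v + w) = b u x v + b u x w;
  bd_hessZl : forall u a v x, b u (a *: v) x = a * b u v x;
  bd_hessZr : forall u a v x, b u x (a *: v) = a * b u x v;
  bd_taylor : forall v h (c : R),
    (forall s : R, 0 <= s <= 1 -> b (v + s *: h) h h <= c) ->
    phi (v + h) <= phi v + d v h + c / 2;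
  diff_bound : forall u h, `|u| < r -> `|d u h| <= M * `|h|;
  hess_bound : forall u h k, `|u| < r -> `|b u h k| <= M * `|h| * `|k|;
  diff_holder : forall u v h, `|u| < r -> `|v| < r ->
    `|d u h - d v h| <= M * `|u - v| `^ alpha * `|h|;
  hess_holder : forall u v h k, `|u| < r -> `|v| < r ->
    `|b u h k - b v h k| <= M * `|u - v| `^ alpha * `|h| * `|k| }.

Lemma bounded_derivatives_exist r : 0 < r -> 0 < alpha ->
  exists2 M, 0 < M & bounded_derivatives (fun u => 'd phi u) (hess phi) r M.
Proof.
move=> r0 a0; have [M M0 MH] := phiH r0; have [dphi hphi _] := phiC2.
have ballP u : `|u| < r -> ball (0 : E) r u.
  by rewrite -ball_normE /= sub0r normrN.
have dH u v h : `|u| < r -> `|v| < r ->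
    `|'d phi u h - 'd phi v h| <= M * `|u - v| `^ alpha * `|h|.
  move=> /ballP ur /ballP vr; have [H _] := MH u v ur vr.
  by apply: dual_norm_le H => a w; rewrite !diff_valZ; ring.
have hH u v h k : `|u| < r -> `|v| < r ->
    `|hess phi u h k - hess phi v h k| <= M * `|u - v| `^ alpha * `|h| * `|k|.
  move=> /ballP ur /ballP vr; have [_ H] := MH u v ur vr.
  apply: (@bilin_norm_le _ _ (fun h k => hess phi u h k - hess phi v h k)) H => a w x.
    by rewrite !(hessZl phiC2) mulrBr.
  by rewrite !(hessZr phiC2) mulrBr.
have [M1 M1P] : exists M1, forall h, `|'d phi 0 h| <= M1 * `|h|.
  have /linear_bounded_continuous/linear_boundedP[N [_ HN]] : continuous ('d phi 0).
    exact: diff_continuous.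
  by exists (`|N| + 1) => h; apply: HN; have := ler_norm N; lra.
have [M2 M2P] : exists M2, forall h k, `|hess phi 0 h k| <= M2 * `|h| * `|k|.
  have [_ + _] := hphi 0.
  case e : (bilin_norm (hess phi 0)) => [x| |] // _.
    exists x => h k; apply: bilin_norm_le; last by rewrite e.
      by move=> a u v; rewrite hessZl.
    by move=> a u v; rewrite hessZr.
  exists 0 => h k; apply: bilin_norm_le; last by rewrite e leNye.
    by move=> a u v; rewrite hessZl.
  by move=> a u v; rewrite hessZr.
have pw u : `|u| < r -> `|u - 0| `^ alpha <= r `^ alpha.
  move=> ur; rewrite subr0; apply: ge0_ler_powR; rewrite ?nnegrE//; exact: ltW.
pose M' := M + M * r `^ alpha + `|M1| + `|M2|.
have MM' : M <= M'.
  have : 0 <= M * r `^ alpha by rewrite mulr_ge0 ?powR_ge0 ?ltW.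
  have := normr_ge0 M1; have := normr_ge0 M2; rewrite /M'; lra.
exists M'; first exact: lt_le_trans MM'.
have n0 : `|0 : E| < r by rewrite normr0.
split=> [u v w|u a v|u v w x|u v w x|u a v x|u a v x|v h c|u h ur|u h k ur
    |u v h ur vr|u v h k ur vr].
- exact: diff_valD.
- exact: diff_valZ.
- exact: hessDl.
- exact: hessDr.
- exact: hessZl.
- exact: hessZr.
- exact: second_order_upper.
- have := dH u 0 h ur n0; have := M1P h.
  have : M1 * `|h| <= `|M1| * `|h| by rewrite ler_wpM2r// ler_norm.
  have : M * `|u - 0| `^ alpha * `|h| <= M * r `^ alpha * `|h|.
    by rewrite ler_wpM2r// ler_wpM2l ?pw// ltW.
  have := ler_normD ('d phi u h - 'd phi 0 h) ('d phi 0 h); rewrite subrK.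
  have : 0 <= (M + `|M2|) * `|h| by rewrite mulr_ge0// addr_ge0// ltW.
  rewrite /M'; lra.
- have := hH u 0 h k ur n0; have := M2P h k.
  have : M2 * `|h| * `|k| <= `|M2| * `|h| * `|k|.
    by rewrite ler_wpM2r// ler_wpM2r// ler_norm.
  have : M * `|u - 0| `^ alpha * `|h| * `|k| <= M * r `^ alpha * `|h| * `|k|.
    by rewrite ler_wpM2r// ler_wpM2r// ler_wpM2l ?pw// ltW.
  have := ler_normD (hess phi u h k - hess phi 0 h k) (hess phi 0 h k); rewrite subrK.
  have : 0 <= (M + `|M1|) * `|h| * `|k| by rewrite !mulr_ge0// addr_ge0// ltW.
  rewrite /M'; move: (hess phi u h k) (hess phi 0 h k) => x y; lra.
- apply: le_trans (dH u v h ur vr) _.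
  by rewrite ler_wpM2r// ler_wpM2r ?powR_ge0.
- apply: le_trans (hH u v h k ur vr) _.
  by rewrite ler_wpM2r// ler_wpM2r// ler_wpM2r ?powR_ge0.
Qed.

End Bounds.

Lemma le_powR_unit (R : realType) (x a : R) :
  0 <= x <= 1 -> 0 < a <= 1 -> x <= x `^ a.
Proof.
case/andP=> x0 x1 /andP[a0 a1]; have [->|xn0] := eqVneq x 0; first exact: powR_ge0.
rewrite -[leLHS](powRr1 x0); apply: ger_powR => //.
by rewrite x1 lt_neqAle eq_sym xn0 x0.
Qed.

Section LocalEstimate.
Variables (R : realType) (E : normedModType R) (q : E -> E -> R) (mu : R).
Variables (phi : E -> R) (d : E -> E -> R) (b : E -> E -> E -> R).
Variables (alpha r M : R).
Hypotheses (qE : weak_inner q) (mu0 : 0 < mu) (alpha01 : 0 < alpha <= 1).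
Hypotheses (r1 : 1 < r) (M0 : 0 < M) (bM : bounded_derivatives phi alpha d b r M).
Local Notation proj := (tangent_proj q mu).
Local Notation step := (sphere_step q mu).
Local Notation S := (sphere q mu).

(** The second derivative of the Lagrangian with the multiplier frozen at [u] *)
Let Q u v w : R := b u v w - d u u / mu * q v w.

Lemma lagrangian_hess_bound u v w : `|u| < r ->
  `|Q u v w| <= (M + M * r / mu) * `|v| * `|w|.
Proof.
rewrite /Q => ur; apply: le_trans (ler_normB _ _) _.
have -> : (M + M * r / mu) * `|v| * `|w| =
    M * `|v| * `|w| + M * r / mu * (`|v| * `|w|) by ring.
apply: lerD; first exact: (hess_bound bM).
rewrite !normrM; apply: ler_pM => //; last exact: (inner_le qE).
rewrite normfV (gtr0_norm mu0) ler_pM2r ?invr_gt0//.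
apply: le_trans (diff_bound bM _ ur) _.
by rewrite ler_wpM2l// ltW.
Qed.

Let model_diffN u v : d u (- v) = - d u v.
Proof. by rewrite -scaleN1r (bd_diffZ bM) mulN1r. Qed.

(** Along a step of length [s] from [v] towards [w], with [v] at distance [rho]
    of [u]: the second order term is read at [u], the first order one at [v],
    where the sign of the slope is prescribed. *)
Record step_estimate (C rho s : R) (u v w : E) : Prop := StepEstimate {
  step_on_sphere : S (step v (s *: proj v w));
  step_short : `|step v (s *: proj v w) - v| <= C * s;
  step_descent : phi (step v (s *: proj v w)) <=
    phi v + s * d v (proj v w) + s ^+ 2 / 2 * Q u w w
      + C * rho `^ alpha * s ^+ 2;
  step_slope : `|d v (proj v w) - d u w| <= C * rho `^ alpha;
  step_D2 : Q u w w <= C }.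

(** As [v] and the end point [y] lie on the sphere, [2 q v h + q h h = 0] for
    [h = y - v]; adding this multiple of the constraint with the multiplier
    [d u u / mu] replaces [b u h h] by the Hessian [Q u h h] of the Lagrangian.
    The radial component of the step then only meets [d v v - d u u], which is
    small. *)
Lemma local_estimate : exists2 C, 1 <= C &
  forall rho s u v w, S u -> S v -> `|u| < r - 1 -> `|v - u| <= rho ->
    C * rho <= 1 -> q u w = 0 -> `|w| <= 1 -> 0 <= s -> s <= rho ->
    step_estimate C rho s u v w.
Proof.
have r0 : 0 < r by exact: lt_trans r1.
have [M_gt0 r_gt1 mu_gt0] := And3 M0 r1 mu0.
have [a0 a1] : 0 < alpha /\ alpha <= 1 by case/andP: alpha01.
pose c1 := 2 * r / mu; pose L := 1 + c1; pose K := M + M * r / mu.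
have c10 : 0 <= c1 by rewrite divr_ge0 ?ltW// mulr_gt0.
have L1 : 1 <= L by rewrite lerDl.
have K0 : 0 <= K by rewrite addr_ge0 ?divr_ge0 ?mulr_ge0 ?ltW.
(* [T1], [T2], [T3] bound the errors of the radial correction, of replacing [h]
   by [s *: w] in the second order term, and of the Hoelder modulus. *)
pose T1 := (M * r + M) / mu.
have T10 : 0 <= T1 by rewrite divr_ge0 ?ltW// addr_gt0 ?mulr_gt0.
pose T2 := K * (2 * c1 + c1 ^+ 2) / 2.
have T20 : 0 <= T2.
  by rewrite divr_ge0// mulr_ge0// addr_ge0 ?sqr_ge0// mulr_ge0.
pose T3 := M * (1 + L) * L ^+ 2 / 2.
have T30 : 0 <= T3 by rewrite divr_ge0// mulr_ge0 ?sqr_ge0// mulr_ge0; lra.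
have imu : 0 < mu^-1 by rewrite invr_gt0.
pose C := 1 + mu^-1 + (1 + L) + (T1 + T2 + T3) + K + K.
exists C; first by rewrite /C; lra.
move=> rho s u v w Su Sv ur vu Crho uw w1 s0 srho.
have rho0 : 0 <= rho := le_trans (normr_ge0 _) vu.
have Lrho : (1 + L) * rho <= 1.
  by apply: le_trans Crho; rewrite ler_wpM2r// /C; lra.
have rho1 : rho <= 1.
  by apply: le_trans Lrho; rewrite ler_peMl//; lra.
have rhomu : rho <= mu.
  rewrite -[leRHS]mulr1 -ler_pdivrMl//; apply: le_trans Crho.
  by rewrite ler_wpM2r// /C; lra.
have rhoa : rho <= rho `^ alpha by rewrite le_powR_unit// rho0.
have ra0 : 0 <= rho `^ alpha := powR_ge0 _ _.
have smu : s ^+ 2 <= mu.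
  apply: le_trans rhomu; rewrite expr2; apply: (le_trans _ (srho)).
  by rewrite ler_piMl//; exact: le_trans srho rho1.
have ur' : `|u| < r by lra.
have vr : `|v| < r.
  by have := ler_normD (v - u) u; rewrite subrK; lra.
have [k [e [hE ke hw eb]]] := step_expansion qE mu0 (ltW r1) Su Sv (ltW vr) vu
  rho1 uw w1 s0 srho smu.
set y := step v _ in hE hw *; set h := y - v in hE hw.
have vhy : v + h = y by rewrite /h addrC subrK.
have yE : step v (s *: proj v w) = y by [].
have Sy : S y.
  apply: (sphere_stepP qE mu0) => //.
    by rewrite (innerZr qE) (tangent_projE qE mu0)// mulr0.
  rewrite (innerZl qE) (innerZr qE) mulrA -expr2; apply: le_trans smu.
  rewrite ler_piMr ?sqr_ge0//; apply: le_trans (tangent_proj_sq qE mu0 w Sv) _.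
  apply: le_trans (ler_norm _) _; apply: le_trans (inner_le qE _ _) _.
  by rewrite -[leRHS]mulr1; exact: ler_pM.
clearbody h y.
have hs : `|h| <= L * s.
  rewrite hw; apply: le_trans (ler_normD _ _) _.
  rewrite normrZ (ger0_norm s0) /L mulrDl mul1r; apply: lerD.
    by rewrite ler_piMr.
  apply: le_trans eb _; rewrite -/c1 ler_piMr// mulr_ge0//.
have qvw : `|q v w| <= rho.
  have -> : q v w = q (v - u) w by rewrite (innerDl qE) (innerNl qE) uw subr0.
  apply: le_trans (inner_le qE _ _) _; rewrite -[leRHS]mulr1.
  exact: ler_pM.
have vua : `|v - u| `^ alpha <= rho `^ alpha.
  by apply: ge0_ler_powR => //; rewrite ?nnegrE// ltW.
have dvu x : `|d v x - d u x| <= M * rho `^ alpha * `|x|.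
  apply: le_trans (diff_holder bM _ vr ur') _.
  by rewrite ler_wpM2r// ler_wpM2l// ltW.
split; rewrite ?yE //.
- have -> : y - v = h by rewrite -vhy addrC addKr.
  by apply: le_trans hs _; rewrite ler_wpM2r// /C; lra.
- have hessb (t : R) : 0 <= t <= 1 ->
      b (v + t *: h) h h <= b u h h + 2 * T3 * rho `^ alpha * s ^+ 2.
    case/andP=> t0 t1.
    have tu : `|v + t *: h - u| <= (1 + L) * rho.
      have -> : v + t *: h - u = (v - u) + t *: h by rewrite addrAC.
      apply: le_trans (ler_normD _ _) _; rewrite mulrDl mul1r lerD//.
      rewrite normrZ (ger0_norm t0); apply: (@le_trans _ _ `|h|); first by rewrite ler_piMl.
      by apply: le_trans hs _; rewrite ler_wpM2l//; lra.
    have tr : `|v + t *: h| < r.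
      by have := ler_normD (v + t *: h - u) u; rewrite subrK; lra.
    have := hess_holder bM h h tr ur'; rewrite ler_norml => /andP[_ H].
    suff : M * `|v + t *: h - u| `^ alpha * `|h| * `|h| <= 2 * T3 * rho `^ alpha * s ^+ 2.
      lra.
    have -> : 2 * T3 * rho `^ alpha * s ^+ 2 =
        M * ((1 + L) * rho `^ alpha) * (L * s) * (L * s) by rewrite /T3; field.
    have P1 : `|v + t *: h - u| `^ alpha <= (1 + L) * rho `^ alpha.
      apply: (@le_trans _ _ (((1 + L) * rho) `^ alpha)).
        apply: ge0_ler_powR => //; rewrite ?nnegrE ?(ltW a0)//.
        by rewrite mulr_ge0//; lra.
      rewrite powRM//; last lra.
      rewrite ler_wpM2r// -[leRHS]powRr1; last lra.
      by apply: ler_powR => //; lra.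
    apply: ler_pM => //; first by rewrite !mulr_ge0 ?powR_ge0 ?(ltW M0).
    apply: ler_pM => //; first by rewrite !mulr_ge0 ?powR_ge0 ?(ltW M0).
    by rewrite ler_wpM2l// ltW.
  have := bd_taylor bM hessb.
  rewrite vhy.
  have dvh : d v h = s * d v (proj v w) + k * d v v.
    by rewrite hE (bd_diffD bM) !(bd_diffZ bM).
  have qvh : q v h = k * mu.
    rewrite hE (innerDr qE) !(innerZr qE) (tangent_projE qE mu0)//.
    by rewrite mulr0 add0r Sv.
  have qhh : 2 * q v h + q h h = 0.
    have : q (v + h) (v + h) = mu by rewrite vhy.
    rewrite !(innerDl qE) !(innerDr qE) Sv (innerC qE h v); lra.
  have D2h : b u h h = Q u h h - 2 * (k * d u u).
    rewrite /Q; have -> : q h h = - 2 * (k * mu) by lra.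
    by field; exact: lt0r_neq0.
  have kd : k * (d v v - d u u) <= T1 * rho `^ alpha * s ^+ 2.
    apply: le_trans (ler_norm _) _; rewrite normrM.
    have -> : T1 * rho `^ alpha * s ^+ 2 = s ^+ 2 / mu * ((M * r + M) * rho `^ alpha).
      by rewrite /T1; field; exact: lt0r_neq0.
    apply: ler_pM => //.
    have -> : d v v - d u u = (d v v - d u v) + d u (v - u).
      by rewrite (bd_diffD bM) model_diffN; ring.
    apply: le_trans (ler_normD _ _) _; rewrite mulrDl; apply: lerD.
      apply: le_trans (dvu v) _; rewrite mulrAC ler_wpM2r// ler_wpM2l// ltW//.
    apply: le_trans (diff_bound bM _ ur') _; rewrite ler_wpM2l ?(ltW M0)//.
    exact: le_trans vu rhoa.
  have D2s : Q u h h <= s ^+ 2 * Q u w w + 2 * T2 * rho `^ alpha * s ^+ 2.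
    have -> : Q u h h = s ^+ 2 * Q u w w + s * Q u w e + s * Q u e w + Q u e e.
      rewrite hw /Q (bd_hessDl bM) !(bd_hessDr bM) !(bd_hessZl bM) !(bd_hessZr bM).
      rewrite (innerDl qE) !(innerDr qE) !(innerZl qE) !(innerZr qE); ring.
    have B1 x z : Q u x z <= K * `|x| * `|z|.
      by apply: le_trans (ler_norm _) _; exact: lagrangian_hess_bound.
    have eb' : `|e| <= c1 * s * rho by [].
    have e1 : s * Q u w e <= K * c1 * s ^+ 2 * rho.
      have -> : K * c1 * s ^+ 2 * rho = s * (K * 1 * (c1 * s * rho)) by ring.
      rewrite ler_wpM2l//; apply: le_trans (B1 _ _) _; apply: ler_pM => //.
        by rewrite mulr_ge0.
      by rewrite ler_wpM2l.
    have e2 : s * Q u e w <= K * c1 * s ^+ 2 * rho.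
      have -> : K * c1 * s ^+ 2 * rho = s * (K * (c1 * s * rho) * 1) by ring.
      rewrite ler_wpM2l//; apply: le_trans (B1 _ _) _; apply: ler_pM => //.
        by rewrite mulr_ge0.
      by rewrite ler_wpM2l.
    have e3 : Q u e e <= K * c1 ^+ 2 * s ^+ 2 * rho.
      apply: (@le_trans _ _ (K * (c1 * s * rho) * (c1 * s * rho))).
        apply: le_trans (B1 _ _) _; apply: ler_pM => //; first by rewrite mulr_ge0.
        by rewrite ler_wpM2l.
      have -> : K * (c1 * s * rho) * (c1 * s * rho) = K * c1 ^+ 2 * s ^+ 2 * rho * rho by ring.
      by apply: ler_piMr => //; apply: mulr_ge0 => //; apply: mulr_ge0 (sqr_ge0 _);
        apply: mulr_ge0 (sqr_ge0 _).
    have e4 : 2 * T2 * s ^+ 2 * rho <= 2 * T2 * s ^+ 2 * rho `^ alpha.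
      by apply: ler_wpM2l => //; apply: mulr_ge0 (sqr_ge0 _); exact: mulr_ge0.
    have e5 : 2 * T2 * s ^+ 2 * rho = 2 * (K * c1 * s ^+ 2 * rho) + K * c1 ^+ 2 * s ^+ 2 * rho.
      by rewrite /T2; field.
    lra.
  have CT : (T1 + T2 + T3) * (rho `^ alpha * s ^+ 2) <= C * (rho `^ alpha * s ^+ 2).
    by rewrite ler_wpM2r ?mulr_ge0 ?sqr_ge0// /C; lra.
  rewrite dvh D2h; lra.
- have -> : d v (proj v w) - d u w =
      (d v w - d u w) - q v w / mu * d v v.
    by rewrite /tangent_proj (bd_diffD bM) model_diffN (bd_diffZ bM); ring.
  apply: le_trans (ler_normB _ _) _.
  apply: (@le_trans _ _ (K * rho `^ alpha)); last by rewrite ler_wpM2r// /C; lra.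
  rewrite /K mulrDl; apply: lerD.
    apply: le_trans (dvu w) _; rewrite ler_piMr// mulr_ge0// ltW//.
  rewrite normrM normrM normfV (gtr0_norm mu0).
  have -> : M * r / mu * rho `^ alpha = rho `^ alpha / mu * (M * r) by ring.
  apply: ler_pM => //; first by rewrite divr_ge0// ltW.
    by rewrite ler_pM2r//; exact: le_trans qvw rhoa.
  by apply: le_trans (diff_bound bM _ vr) _; rewrite ler_wpM2l// ltW.
- apply: le_trans (ler_norm _) _; apply: le_trans (lagrangian_hess_bound w w ur') _.
  apply: (@le_trans _ _ (K * 1 * 1)); last by rewrite /C; lra.
  apply: ler_pM => //; first by rewrite mulr_ge0.
  by rewrite ler_wpM2l.
Qed.

End LocalEstimate.

(** * Continuity of steps *)

Section ContinuityOfSteps.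
Variables (R : realType) (E : normedModType R) (q : E -> E -> R) (mu : R).
Hypotheses (qE : weak_inner q).
Variables (T : Type) (F : set_system T) (FF : Filter F).
Variables (f g : T -> E) (a b : E).
Hypotheses (fa : f x @[x --> F] --> a) (gb : g x @[x --> F] --> b).

Lemma cvg_inner : q (f x) (g x) @[x --> F] --> q a b.
Proof.
apply/(@subr_cvg0 _ R^o).
have H : `|f x - a| * `|g x| + `|a| * `|g x - b| @[x --> F] --> 0.
  rewrite -(addr0 0) -[X in X + _](mul0r `|b|) -[X in _ + X](mulr0 `|a|).
  have fa0 : `|f x - a| @[x --> F] --> (0 : R).
    by rewrite -(normr0 E); apply: cvg_norm; apply/subr_cvg0.
  have gb0 : `|g x - b| @[x --> F] --> (0 : R).
    by rewrite -(normr0 E); apply: cvg_norm; apply/subr_cvg0.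
  apply: cvgD; apply: cvgM => //; [exact: cvg_norm|exact: cvg_cst].
apply/cvgr0Pnorm_le => e e0; have /cvgr0Pnorm_le/(_ e e0) := H.
apply: filterS => x; apply: le_trans.
have -> : q (f x) (g x) - q a b = q (f x - a) (g x) + q a (g x - b).
  by rewrite (innerDl qE) (innerDr qE) (innerNl qE) (innerNr qE); ring.
apply: le_trans (ler_normD _ _) _; apply: le_trans (ler_norm _).
by apply: lerD; exact: (inner_le qE).
Qed.

Lemma cvg_tangent_proj :
  tangent_proj q mu (f x) (g x) @[x --> F] --> tangent_proj q mu a b.
Proof.
apply: cvgB => //; apply: cvgZ => //; apply: cvgM; first exact: cvg_inner.
exact: cvg_cst.
Qed.

End ContinuityOfSteps.

Lemma cvg_sphere_step (R : realType) (E : normedModType R) (q : E -> E -> R)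
    (mu : R) (T : Type) (F : set_system T) (f g : T -> E) (a b : E) :
  weak_inner q -> Filter F -> f x @[x --> F] --> a -> g x @[x --> F] --> b ->
  sphere_step q mu (f x) (g x) @[x --> F] --> sphere_step q mu a b.
Proof.
move=> qE FF fa gb; apply: cvgD => //; apply: cvgZ => //.
apply: (cvg_comp (fun x => 1 - q (g x) (g x) / mu) Num.sqrt); last exact: sqrt_continuous.
apply: cvgB; first exact: cvg_cst.
by apply: cvgM; [exact: cvg_inner|exact: cvg_cst].
Qed.

(** The Hessian makes the differential Lipschitz near each point, uniformly in
    the direction, so the direction may vary along with the base point. *)
Lemma slope_continuous (R : realType) (E : normedModType R) (q : E -> E -> R)
    (mu : R) (phi : E -> R) (w : E) : weak_inner q -> C2 phi ->
  continuous (fun v => 'd phi v (tangent_proj q mu v w)).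
Proof.
move=> qE phiC2 u; have [dphi hphi _] := phiC2.
have projc : tangent_proj q mu v w @[v --> u] --> tangent_proj q mu u w.
  by apply: cvg_tangent_proj => //; exact: cvg_cst.
have [M M0 MP] : exists2 M, 0 < M & forall h k, `|hess phi u h k| <= M * `|h| * `|k|.
  have [_ + _] := hphi u.
  case e : (bilin_norm (hess phi u)) => [x| |] // _.
    exists (`|x| + 1) => [|h k]; first by rewrite ltr_wpDl.
    apply: bilin_norm_le; last by rewrite e lee_fin; have := ler_norm x; lra.
      by move=> a y v; rewrite hessZl.
    by move=> a y v; rewrite hessZr.
  exists 1 => // h k; apply: bilin_norm_le; last by rewrite e leNye.
    by move=> a y v; rewrite hessZl.
  by move=> a y v; rewrite hessZr.
have lip : \forall v \near u, forall k, `|'d phi v k - 'd phi u k| <= (M + 1) * `|v - u| * `|k|.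
  have [_ _ /(_ 1 ltr01)/nbhs_ballP[e /= e0 He]] := hphi u.
  apply/nbhs_ballP; exists e => //= v; rewrite -ball_normE /= => uv k.
  have : ball 0 e (v - u) by rewrite -ball_normE /= sub0r opprB.
  move=> /He H.
  have H1 : `|'d phi v k - 'd phi u k - hess phi u (v - u) k| <= 1 * `|v - u| * `|k|.
    have -> : v = u + (v - u) by rewrite addrC subrK.
    rewrite [u + (v - u) - u]addrAC subrr add0r; apply: (dual_norm_le _ _ H) => a x.
    by rewrite !(diff_valZ phi) (hessZr phiC2) -!mulrBr.
  have := MP (v - u) k.
  have := ler_normD ('d phi v k - 'd phi u k - hess phi u (v - u) k)
    (hess phi u (v - u) k).
  rewrite subrK; move: ('d phi v k - 'd phi u k) (hess _ _ _ _) H1 => x y; lra.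
apply/(@subr_cvg0 _ R^o).
have -> : (fun v => 'd phi v (tangent_proj q mu v w) - 'd phi u (tangent_proj q mu u w)) =
   (fun v => ('d phi v (tangent_proj q mu v w) - 'd phi u (tangent_proj q mu v w)) +
      ('d phi u (tangent_proj q mu v w) - 'd phi u (tangent_proj q mu u w))).
  by apply/funext => v; rewrite addrA subrK.
rewrite -(addr0 0); apply: cvgD.
  have H : (M + 1) * `|v - u| * `|tangent_proj q mu v w| @[v --> u] --> 0.
    rewrite -[X in _ --> X](mul0r `|tangent_proj q mu u w|); apply: cvgM; last exact: cvg_norm.
    rewrite -[X in _ --> X](mulr0 (M + 1)); apply: cvgM; first exact: cvg_cst.
    by rewrite -(normr0 E); apply: cvg_norm; apply/subr_cvg0; exact: cvg_id.
  apply/cvgr0Pnorm_le => e e0; have /cvgr0Pnorm_le/(_ e e0) := H.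
  apply: filterS2 lip => v Hv; apply: le_trans; apply: le_trans (ler_norm _).
  exact: Hv.
apply/(@subr_cvg0 _ R^o).
have dc : continuous ('d phi u) by exact: diff_continuous.
exact: (cvg_comp _ _ projc (dc _)).
Qed.

(** * Points of local descent *)

Section Descent.
Variables (R : realType) (E : normedModType R) (q : E -> E -> R) (mu : R).
Variables (phi : E -> R) (n : nat) (D : set 'rV[R]_n).
Hypotheses (qE : weak_inner q) (mu0 : 0 < mu).
Local Notation proj := (tangent_proj q mu).
Local Notation step := (sphere_step q mu).
Local Notation S := (sphere q mu).

(** Directions [sigma] are chosen for a whole map [g] at once, because continuity
    in the parameter is the point; [kappa] absorbs the perturbation that removes
    the zeros of the slope.  Only values of [phi] on the sphere occur, hence the
    invariance of this property under [u |-> - u] when [phi] is even there. *)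
Definition descent_near (C rho t c : R) (u : E) : Prop :=
  forall (g : 'rV[R]_n -> E) (kappa : R), 0 < kappa ->
  {within D, continuous g} -> (forall x, D x -> S (g x)) ->
  exists2 sigma : 'rV[R]_n -> E, {within D, continuous sigma} &
    forall x (s : R), D x -> `|g x - u| <= rho -> 0 <= s <= t ->
    let y := step (g x) (s *: proj (g x) (sigma x)) in
    [/\ S y, `|y - g x| <= C * s & phi y <= phi (g x) + kappa - c * s ^+ 2].

Lemma descent_nearN C rho t c u : (forall v, S v -> phi (- v) = phi v) ->
  descent_near C rho t c u -> descent_near C rho t c (- u).
Proof.
move=> phiN du g kappa k0 gc gS.
have gNc : {within D, continuous (fun x => - g x)}.
  apply/subspace_continuousP => x Dx; apply: cvgN.
  by have /subspace_continuousP := gc; apply.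
have [x Dx|sigma sc sP] := du (fun x => - g x) kappa k0 gNc.
  exact/(sphereN qE)/gS.
exists (fun x => - sigma x).
  apply/subspace_continuousP => x Dx; apply: cvgN.
  by have /subspace_continuousP := sc; apply.
move=> x s Dx gu st /=.
have [|] := sP x s Dx _ st; first by rewrite -opprD normrN -[u]opprK.
have -> : step (- g x) (s *: proj (- g x) (sigma x)) =
    - step (g x) (s *: proj (g x) (- sigma x)).
  by rewrite (tangent_projNl _ qE) -(sphere_stepN _ qE) (tangent_projN _ qE) scalerN opprK.
move=> /(sphereN qE); rewrite opprK => Sy; rewrite -opprD normrN => yg.
by rewrite !phiN//; exact: gS.
Qed.

Section Model.
Variables (d : E -> E -> R) (b : E -> E -> E -> R) (C alpha r rho t beta : R).
Hypothesis loc : forall rho s u v w, S u -> S v -> `|u| < r - 1 ->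
  `|v - u| <= rho -> C * rho <= 1 -> q u w = 0 -> `|w| <= 1 -> 0 <= s ->
  s <= rho -> step_estimate q mu phi d b alpha C rho s u v w.
Hypotheses (C1 : 1 <= C) (alpha01 : 0 < alpha <= 1) (rho0 : 0 < rho).
Hypotheses (Crho : C * rho <= 1) (trho : t <= rho) (beta0 : 0 < beta).
Hypothesis Crhoa : C * rho `^ alpha <= beta / 8.

Let rho1 : rho <= 1.
Proof. by apply: le_trans Crho; rewrite ler_peMl// ltW. Qed.

(** With a slope below [- 3 beta] one fixed direction works: on the scale [rho]
    both the variation of the slope and the second order term are small with
    respect to [beta]. *)
Lemma descent_gradient u w : S u -> `|u| < r - 1 -> q u w = 0 -> `|w| <= 1 ->
  d u w <= - (3 * beta) -> descent_near C rho t (beta / 4) u.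
Proof.
move=> Su ur uw w1 duw g kappa k0 gc gS.
exists (fun=> w); first by apply/subspace_continuousP => x Dx; exact: cvg_cst.
move=> x s Dx gu /andP[s0 st]; have srho : s <= rho := le_trans st trho.
have [Sy yg desc slope Qw] := loc Su (gS x Dx) ur gu Crho uw w1 s0 srho.
split => //; apply: le_trans desc _.
move: slope; rewrite ler_norml => /andP[_ slope].
have Crho' : C * s <= beta / 8.
  apply: le_trans Crhoa; rewrite ler_wpM2l ?(le_trans ler01 C1)//.
  apply: le_trans srho _; apply: le_powR_unit => //.
  by rewrite (ltW rho0).
have s1 : s <= 1 := le_trans srho rho1.
have h0 : s ^+ 2 <= s by rewrite expr2 ler_piMl.
have h1 : s * d (g x) (proj (g x) w) <= s * (- (3 * beta) + beta / 8).
  by rewrite ler_wpM2l//; move: Crhoa duw; lra.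
have h2 : s ^+ 2 / 2 * (b u w w - d u u / mu * q w w) <= s * (beta / 16).
  apply: (@le_trans _ _ (s ^+ 2 / 2 * C)).
    by rewrite ler_wpM2l// divr_ge0// sqr_ge0.
  have -> : s ^+ 2 / 2 * C = s * (C * s / 2) by field.
  by rewrite ler_wpM2l//; lra.
have h3 : C * rho `^ alpha * s ^+ 2 <= beta / 8 * s ^+ 2 by rewrite ler_wpM2r ?sqr_ge0.
have h4 : beta * s ^+ 2 <= beta * s by rewrite ler_wpM2l// ltW.
have h5 : 0 <= s * beta by rewrite mulr_ge0// ltW.
move: h1 h2 h3; set X := s * d _ _; set Y := _ / 2 * (_ - _); set Z := C * _ * _.
clearbody X Y Z; lra.
Qed.

(** The section given by [unit_section] for the slopes along the [B i] makes the
    first order term at most [kappa], leaving the negative second order one. *)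
Lemma descent_hess (B : 'I_n.+1 -> E) u : compact D -> S u -> `|u| < r - 1 ->
  (forall w, continuous (fun v => d v (proj v w))) ->
  (forall v w x, d v (w + x) = d v w + d v x) ->
  (forall v a w, d v (a *: w) = a * d v w) ->
  (forall a : 'I_n.+1 -> R, \sum_i a i *: B i = 0 -> forall i, a i = 0) ->
  (forall a : 'I_n.+1 -> R, let w := \sum_i a i *: B i in
     q u w = 0 /\ b u w w - d u u / mu * q w w <= - beta * `|w| ^+ 2) ->
  descent_near C rho t (beta / 4) u.
Proof.
move=> cD Su ur dcont dD dZ B_free BP g kappa k0 gc gS.
have lc i : {within D, continuous (fun x => d (g x) (proj (g x) (B i)))}.
  apply/subspace_continuousP => x Dx.
  have /subspace_continuousP/(_ x Dx) gx := gc.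
  exact: (cvg_comp _ _ gx (dcont (B i) (g x))).
have [a [ac a1 al]] := unit_section cD B_free lc k0.
exists (fun x => \sum_i a i x *: B i).
  apply/subspace_continuousP => x Dx.
  apply: (@cvg_lincomb R E _ (within D (nbhs x)) _ B a) => k.
  by have /subspace_continuousP := ac k; apply.
move=> x s Dx gu /andP[s0 st]; have srho : s <= rho := le_trans st trho.
have [uw Qw] := BP (fun i => a i x).
have w1 := a1 x Dx.
have dw : d (g x) (proj (g x) (\sum_i a i x *: B i)) <= kappa.
  apply: le_trans (al x Dx).
  suff H (k : nat) (c : 'I_k -> R) (A : 'I_k -> E) :
      d (g x) (proj (g x) (\sum_i c i *: A i)) = \sum_i c i * d (g x) (proj (g x) (A i)).
    by rewrite H.
  elim: k c A => [|k IH] c A.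
    by rewrite !big_ord0 (tangent_proj0 _ qE) -(scale0r (0 : E)) dZ mul0r.
  by rewrite !big_ord_recr /= (tangent_projD _ qE) dD (tangent_projZ _ qE) dZ IH.
move: uw Qw w1 dw; set w := \sum_i _ *: _ => uw Qw w1 dw; clearbody w.
have w1' : `|w| <= 1 by rewrite w1.
have [Sy yg desc _ _] := loc Su (gS x Dx) ur gu Crho uw w1' s0 srho.
split => //; apply: le_trans desc _.
have s1 : s <= 1 := le_trans srho rho1.
have h1 : s * d (g x) (proj (g x) w) <= kappa.
  apply: (@le_trans _ _ (s * kappa)); first by rewrite ler_wpM2l.
  by rewrite ler_piMl// ltW.
have h2 : s ^+ 2 / 2 * (b u w w - d u u / mu * q w w) <= s ^+ 2 / 2 * - beta.
  rewrite ler_wpM2l ?divr_ge0 ?sqr_ge0//.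
  by apply: le_trans Qw _; rewrite w1 expr1n mulr1.
have h3 : C * rho `^ alpha * s ^+ 2 <= beta / 8 * s ^+ 2 by rewrite ler_wpM2r ?sqr_ge0.
have h5 : 0 <= beta * s ^+ 2 by rewrite mulr_ge0 ?sqr_ge0// ltW.
move: h1 h2 h3; set X := s * d _ _; set Y := _ / 2 * (_ - _); set Z := C * _ * _.
clearbody X Y Z; lra.
Qed.

End Model.
End Descent.

(** * A cover of bounded multiplicity *)

(** The centres of a cubic grid of spacing [2 h]: in each coordinate at most two
    of them are at distance less than [2 h] of a given point. *)
Lemma grid_cover (R : realType) (n : nat) (M h : R) : 0 < M -> 0 < h ->
  exists (I : finType) (p : I -> 'rV[R]_n),
    (forall x : 'rV[R]_n, (forall k, `|x 0 k| < M) -> exists i, `|x - p i| <= h) /\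
    (forall x : 'rV[R]_n, (#|[pred i | (`|x - p i| < 2 * h)%R]| <= 2 ^ n)%N).
Proof.
move=> M0 h0; pose N := (Num.truncn (M / h)).+2.
pose p (z : {ffun 'I_n -> 'I_N}) : 'rV[R]_n := \row_k (2 * h * (z k)%:R - M).
exists {ffun 'I_n -> 'I_N}, p; split=> [x xM|x].
- pose y k := (x 0 k + M) / (2 * h).
  have yb k : 0 <= y k < M / h.
    have := xM k; rewrite ltr_norml => /andP[xl xr].
    rewrite /y divr_ge0//=; [|lra|lra].
    have -> : M / h = 2 * M / (2 * h) by field; exact: lt0r_neq0.
    by rewrite ltr_pM2r ?invr_gt0//; lra.
  have zN k : (Num.truncn (y k + 2^-1) < N)%N.
    have /andP[y0 yM] := yb k.
    rewrite -(ltr_nat R).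
    have /truncn_itv/andP[z1 _] : 0 <= y k + 2^-1 by lra.
    have /truncn_itv/andP[_ z2] : 0 <= M / h by rewrite divr_ge0// ltW.
    rewrite /N -natr1; lra.
  exists [ffun k => Ordinal (zN k)]; apply/normrV_le; first exact: ltW.
  move=> k; rewrite !mxE ffunE /=.
  have /andP[y0 yM] := yb k.
  have /truncn_itv/andP[] : 0 <= y k + 2^-1 by lra.
  rewrite -[X in _ < X]natr1; set m : R := (Num.truncn _)%:R => z1 z2.
  have -> : x 0 k - (2 * h * m - M) = 2 * h * (y k - m).
    by rewrite /y; field; exact: lt0r_neq0.
  rewrite normrM ger0_norm; last lra.
  have H : `|y k - m| <= 2^-1.
    by rewrite ler_norml; apply/andP; split; lra.
  have := ler_wpM2l (ltW h0) H; lra.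
- pose T k := [pred j : 'I_N | `|x 0 k - (2 * h * j%:R - M)| < 2 * h].
  have T2 k : (#|T k| <= 2)%N.
    pose y := (x 0 k + M) / (2 * h); pose m := Num.truncn y.
    have jm (j : 'I_N) : j \in T k -> (j : nat) \in [:: m; m.+1].
      rewrite inE /=.
      have -> : x 0 k - (2 * h * j%:R - M) = 2 * h * (y - j%:R).
        by rewrite /y; field; exact: lt0r_neq0.
      rewrite normrM ger0_norm; last lra.
      rewrite gtr_pMr; last lra.
      rewrite ltr_norml => /andP[j1 j2]; rewrite !inE.
      have [y0|y0] := leP 0 y.
        have /andP[m1] := truncn_itv y0.
        rewrite -[X in _ < X]natr1 -/m => m2.
        have jm1 : (m < j.+1)%N by rewrite -(ltr_nat R) -[X in _ < X]natr1; lra.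
        have jm2 : (j < m.+2)%N.
          by rewrite -(ltr_nat R) -[X in _ < X]natr1 -[m.+1%:R]natr1; lra.
        rewrite ltnS in jm1; rewrite ltnS in jm2.
        move: jm1; rewrite leq_eqVlt => /orP[/eqP ->|mj]; first by rewrite eqxx.
        by rewrite [X in _ || X]eqn_leq jm2 mj orbT.
      have -> : m = 0%N by apply: truncn0Pn; rewrite -ltNge; lra.
      have j0 : (j < 1)%N by rewrite -(ltr_nat R); lra.
      by move: j0; case: (nat_of_ord j).
    rewrite cardE -(size_map val); apply: (@uniq_leq_size _ _ [:: m; m.+1]).
      by rewrite map_inj_uniq ?enum_uniq//; exact: val_inj.
    by move=> _ /mapP[j + ->]; rewrite mem_enum; exact: jm.
  apply: (@leq_trans #|family (fun k => T k)|).
    apply: subset_leq_card; apply/fintype.subsetP => z; rewrite inE /= => xz.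
    apply/familyP => k; rewrite inE /=; apply: le_lt_trans xz.
    by have := coord_le_norm (x - p z) k; rewrite !mxE.
  have H (l : seq 'I_n) : (foldr muln 1 [seq #|T k| | k <- l] <= 2 ^ size l)%N.
    by elim: l => //= k l IH; rewrite expnS; exact: leq_mul.
  by rewrite card_family; apply: leq_trans (H (enum 'I_n)) _; rewrite size_enum_ord.
Qed.

(** * Equivariant deformations *)

Section Deformation.
Variables (R : realType) (E : normedModType R) (q : E -> E -> R) (mu : R).
Variables (phi : E -> R) (n : nat) (D : set 'rV[R]_n) (inv : 'rV[R]_n -> 'rV[R]_n).
Hypothesis qE : weak_inner q.
Local Notation proj := (tangent_proj q mu).
Local Notation step := (sphere_step q mu).
Local Notation S := (sphere q mu).
Hypothesis phiN : forall v, S v -> phi (- v) = phi v.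
Hypotheses (invK : involutive inv) (Dinv : forall x, D x -> D (inv x)).
Hypothesis inv_cont : {within D, continuous inv}.
Variables (C rho t c : R).
Hypotheses (C0 : 0 <= C) (t0 : 0 <= t) (c0 : 0 <= c).

Lemma within_continuous_inv (W : normedModType R) (f : 'rV[R]_n -> W) :
  {within D, continuous f} -> {within D, continuous (fun x => f (inv x))}.
Proof.
move=> /within_continuousP fc; apply/within_continuousP => x e Dx e0.
have [d d0 fd] := fc (inv x) e (Dinv Dx) e0.
have /within_continuousP/(_ x d Dx d0)[d' d'0 dd] := inv_cont.
by exists d' => // y Dy xy; apply: fd; [exact: Dinv|exact: dd].
Qed.

Definition sphere_map (g : 'rV[R]_n -> E) : Prop :=
  [/\ {within D, continuous g}, forall x, D x -> S (g x)
    & forall x, D x -> g (inv x) = - g x].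

(** The step is mirrored: [V x] combines the direction chosen at [x] and minus the
    one chosen at [inv x].  As [chi] vanishes at one of the two points, only one
    term is present, and the values at [x] and [inv x] control each other by
    oddness. *)
Lemma deformation_step (g : 'rV[R]_n -> E) (chi : 'rV[R]_n -> R) (u : E) (kappa : R) :
  sphere_map g -> 0 < kappa -> descent_near q mu phi D C rho t c u ->
  {within D, continuous chi} -> (forall x, 0 <= chi x <= 1) ->
  (forall x, D x -> chi x != 0 -> `|g x - u| <= rho /\ chi (inv x) = 0) ->
  exists g', [/\ sphere_map g',
    forall x, D x -> chi x = 0 -> chi (inv x) = 0 -> g' x = g x,
    forall x, D x -> `|g' x - g x| <= C * t
    & forall x, D x -> phi (g' x) <= phi (g x) + kappa - c * t ^+ 2 * (chi x == 1)%:R].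
Proof.
move=> [gc gS gN] k0 du chic chi01 chiP.
have [sigma sc sP] := du g kappa k0 gc gS.
pose V x := chi x *: sigma x - chi (inv x) *: sigma (inv x).
pose g' x := step (g x) (t *: proj (g x) (V x)).
have g'N x : D x -> g' (inv x) = - g' x.
  move=> Dx; rewrite /g' gN// (tangent_projNl _ qE).
  have -> : V (inv x) = - V x by rewrite /V invK opprB.
  by rewrite (tangent_projN _ qE) scalerN (sphere_stepN _ qE).
have g'id x : D x -> chi x = 0 -> chi (inv x) = 0 -> g' x = g x.
  move=> Dx x0 y0; rewrite /g' /V x0 y0 !scale0r subrr (tangent_proj0 _ qE) scaler0.
  exact: sphere_step0.
have act x : D x -> chi x != 0 -> [/\ S (g' x), `|g' x - g x| <= C * t
    & phi (g' x) <= phi (g x) + kappa - c * t ^+ 2 * (chi x == 1)%:R].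
  move=> Dx cx; have [gu cy] := chiP x Dx cx; have /andP[cx0 cx1] := chi01 x.
  have -> : g' x = step (g x) ((t * chi x) *: proj (g x) (sigma x)).
    by rewrite /g' /V cy scale0r subr0 (tangent_projZ _ qE) scalerA.
  have [|Sy yg desc] := sP x (t * chi x) Dx gu.
    by rewrite mulr_ge0//= ler_piMr.
  split => //.
    by apply: le_trans yg _; rewrite ler_wpM2l// ler_piMr.
  apply: le_trans desc _; rewrite lerD2l lerN2 exprMn [leRHS]mulrA ler_wpM2l//.
    by rewrite mulr_ge0// sqr_ge0.
  by have [->|_] := eqVneq; rewrite ?expr1n// sqr_ge0.
have act' x : D x -> chi (inv x) != 0 -> [/\ S (g' x), `|g' x - g x| <= C * t
    & phi (g' x) <= phi (g x) + kappa].
  move=> Dx cy; have Dy := Dinv Dx.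
  have [Sy yg desc] := act _ Dy cy.
  have yE : g' x = - g' (inv x) by rewrite g'N// opprK.
  have gE : g x = - g (inv x) by rewrite gN// opprK.
  rewrite yE gE; split; first exact: (sphereN qE).
    by rewrite -opprD normrN.
  rewrite !phiN//; last exact: gS.
  apply: le_trans desc _; rewrite gerBl mulr_ge0// mulr_ge0// sqr_ge0//.
have cases x : D x -> [\/ chi x != 0, chi (inv x) != 0 | chi x = 0 /\ chi (inv x) = 0].
  move=> Dx; have [x0|] := eqVneq (chi x) 0; last by move=> ?; apply: Or31.
  have [y0|] := eqVneq (chi (inv x)) 0; last by move=> ?; apply: Or32.
  exact: Or33.
exists g'; split => //; first split => //.
- apply/subspace_continuousP => x Dx.
  have cv (W : normedModType R) (h : 'rV[R]_n -> W) : {within D, continuous h} ->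
    h y @[y --> within D (nbhs x)] --> h x by move=> /subspace_continuousP; apply.
  apply: cvg_sphere_step => //; first exact: cv.
  apply: cvgZ; first exact: cvg_cst.
  apply: cvg_tangent_proj => //; first exact: cv.
  apply: cvgB; apply: cvgZ; apply: (cv _ _) => //; exact: within_continuous_inv.
- move=> x Dx; have [/(act _ Dx)[]//|/(act' _ Dx)[]//|[x0 y0]] := cases x Dx.
  by rewrite g'id//; exact: gS.
- move=> x Dx; have [/(act _ Dx)[]//|/(act' _ Dx)[]//|[x0 y0]] := cases x Dx.
  by rewrite g'id// subrr normr0 mulr_ge0.
- move=> x Dx; have [cx|cx] := eqVneq (chi x) 1.
    by have := act x Dx; rewrite cx oner_neq0 eqxx => /(_ isT)[].
  rewrite mulr0 subr0; have [/(act _ Dx)[_ _]|/(act' _ Dx)[]//|[x0 y0]] := cases x Dx.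
    by rewrite (negbTE cx) mulr0 subr0.
  by rewrite g'id// lerDl ltW.
Qed.

(** The number of steps depends on the mesh of the charts, but each point is
    moved at most [m] times, so it stays in the domain of validity [rho] of all
    descent directions used on it; a chart equal to [1] at [x] yields a full
    step there. *)
Lemma deformation (I : eqType) (l : seq I) (chi : I -> 'rV[R]_n -> R) (u : I -> E)
    (f : 'rV[R]_n -> E) (rho1 kappa : R) (m : nat) :
  sphere_map f -> 0 < kappa ->
  (forall i, i \in l -> descent_near q mu phi D C rho t c (u i)) ->
  (forall i, {within D, continuous (chi i)}) -> (forall i x, 0 <= chi i x <= 1) ->
  (forall i x, i \in l -> D x -> chi i x != 0 ->
     `|f x - u i| <= rho1 /\ chi i (inv x) = 0) ->
  (forall x, D x -> (count (fun i => chi i x != 0%R) l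
     + count (fun i => chi i (inv x) != 0%R) l <= m)%N) ->
  rho1 + C * t * m%:R <= rho ->
  exists g, [/\ sphere_map g,
    forall x, D x -> (forall i, i \in l -> chi i x = 0 /\ chi i (inv x) = 0) -> g x = f x,
    forall x, D x -> `|g x - f x| <= C * t * (count (fun i => chi i x != 0%R) l
     + count (fun i => chi i (inv x) != 0%R) l)%:R
    & forall x, D x -> phi (g x) <= phi (f x) + kappa * (size l)%:R
        - c * t ^+ 2 * (has (fun i => chi i x == 1) l)%:R].
Proof.
move=> fm k0 + chic chi01 + + Crho.
elim: l => [_ _ _|i l IH du chiP cm].
  exists f; split => // x Dx; first by rewrite subrr normr0 addn0 mulr0.
  by rewrite !mulr0 addr0 subr0.
have [||x Dx|g [gm gid gf gphi]] := IH.
- by move=> k kl; apply: du; rewrite inE kl orbT.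
- by move=> k x kl; apply: chiP; rewrite inE kl orbT.
- by apply: leq_trans (cm x Dx); rewrite /= addnACA leq_addl.
have Ct : 0 <= C * t by rewrite mulr_ge0.
have [|x Dx cx|g' [g'm g'id g'g g'phi]] :=
  @deformation_step g (chi i) (u i) kappa gm k0 _ (chic i) (chi01 i).
- by apply: du; rewrite inE eqxx.
- have [fu ->] := chiP i x (mem_head _ _) Dx cx; split => //.
  rewrite -(subrK (f x) (g x)) -addrA; apply: le_trans (ler_normD _ _) _.
  apply: (@le_trans _ _ (C * t * m%:R + rho1)); last by rewrite addrC.
  apply: lerD => //.
  apply: le_trans (gf x Dx) _; rewrite ler_wpM2l// ler_nat.
  by apply: leq_trans (cm x Dx); rewrite /= addnACA leq_addl.
exists g'; split => // x Dx.
- move=> cl; have [ci cj] := cl i (mem_head _ _).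
  by rewrite g'id// gid// => k kl; apply: cl; rewrite inE kl orbT.
- rewrite /= addnACA natrD mulrDr; rewrite -(subrK (g x) (g' x)) -addrA.
  apply: le_trans (ler_normD _ _) _; apply: lerD; last exact: gf.
  have [ci|ci] := eqVneq (chi i x) 0; last first.
    by apply: le_trans (g'g x Dx) _; rewrite ler_peMr// (ler_nat _ 1%N).
  have [cj|cj] := eqVneq (chi i (inv x)) 0.
    by rewrite g'id// subrr normr0 addn0 mulr0.
  by apply: le_trans (g'g x Dx) _; rewrite mulr1.
- apply: le_trans (g'phi x Dx) _; have := gphi x Dx.
  have ct : 0 <= c * t ^+ 2 by rewrite mulr_ge0// sqr_ge0.
  rewrite /= -natr1 mulrDr mulr1; case: (chi i x == 1); case: (has _ l) => /=; lra.
Qed.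

End Deformation.

(** * Bad points are points of descent *)

(** Expand the square of [`|v| u + a `|u| v] for [a = 1] and [a = -1]. *)
Lemma hilbert_cauchy_schwarz (R : realType) (H : completeNormedModType R)
    (dot : {dot H for idfun}) (u v : H) :
  hilbert_product dot -> `|dot u v| <= `|u| * `|v|.
Proof.
move=> dotE.
have [->|u0] := eqVneq u 0; first by rewrite linear0l !normr0 mul0r.
have [->|v0] := eqVneq v 0; first by rewrite linear0r !normr0 mulr0.
have dotC x y : dot x y = dot y x by rewrite (hermitian_subproof x y) /= expr0 mul1r.
have dotZl a x y : dot (a *: x) y = a * dot x y by rewrite linearZl_LR.
have dotZr a x y : dot x (a *: y) = a * dot x y by rewrite linearZ.
have dotDl x y z : dot (x + y) z = dot x z + dot y z by rewrite linearDl.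
have dotDr x y z : dot z (x + y) = dot z x + dot z y by rewrite linearD.
have key (a : R) : a ^+ 2 = 1 -> 0 <= `|u| * `|v| + a * dot u v.
  move=> a2; have := sqr_ge0 `| `|v| *: u + (a * `|u|) *: v|.
  rewrite -dotE !dotDl !dotDr !dotZl !dotZr !dotE (dotC v u).
  have -> : `|v| * (`|v| * `|u| ^+ 2) + `|v| * (a * `|u| * dot u v) +
      (a * `|u| * (`|v| * dot u v) + a * `|u| * (a * `|u| * `|v| ^+ 2)) =
    (1 + a ^+ 2) * (`|u| * `|v|) ^+ 2 + (2 * `|u| * `|v|) * (a * dot u v) by ring.
  have -> : (1 + a ^+ 2) * (`|u| * `|v|) ^+ 2 + (2 * `|u| * `|v|) * (a * dot u v) =
    (2 * `|u| * `|v|) * (`|u| * `|v| + a * dot u v) by rewrite a2; ring.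
  by rewrite pmulr_rge0// !mulr_gt0 ?normr_gt0.
have := key 1 (expr1n _ _); have := key (-1); rewrite sqrrN expr1n mul1r mulN1r.
by move=> /(_ erefl) ? ?; rewrite ler_norml; apply/andP; split; lra.
Qed.

Lemma weak_inner_pullback (R : realType) (E H : completeNormedModType R)
    (dotH : {dot H for idfun}) (j : {linear E -> H}) :
  hilbert_product dotH -> hilbert_embedding dotH j ->
  weak_inner (pullback dotH j).
Proof.
move=> dotE [_ jle _]; rewrite /pullback; split=> [u v w|a u v|u v|u|u v].
- by rewrite linearD linearDl.
- by rewrite linearZ linearZl_LR.
- by rewrite (hermitian_subproof (j u) (j v)) /= expr0 mul1r.
- by rewrite dotE sqr_ge0.
- by apply: le_trans (hilbert_cauchy_schwarz _ _ dotE) _; exact: ler_pM.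
Qed.

Lemma euclid_isometry_continuous (R : realType) (n : nat)
    (s : 'rV[R]_n -> 'rV[R]_n) (D : set 'rV[R]_n) :
  (forall x y, euclid_dist (s x) (s y) = euclid_dist x y) ->
  {within D, continuous s}.
Proof.
move=> siso; apply/within_continuousP => x e Dx e0.
have sumle (v w : 'rV[R]_n) : euclid_dist v w <= Num.sqrt n%:R * `|v - w|.
  rewrite /euclid_dist -[`|v - w|](ger0_norm (normr_ge0 _)) -sqrtr_sqr -sqrtrM ?ler0n//.
  rewrite ler_sqrt; last by rewrite mulr_ge0// sqr_ge0.
  apply: (@le_trans _ _ (\sum_(i < n) `|v - w| ^+ 2)).
    apply: ler_sum => i _; rewrite -real_normK ?num_real// ler_sqr ?nnegrE//.
    by have := coord_le_norm (v - w) i; rewrite !mxE.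
  by rewrite sumr_const card_ord mulr_natl.
have lesum (v w : 'rV[R]_n) : `|v - w| <= euclid_dist v w.
  apply/normrV_le; first exact: sqrtr_ge0.
  move=> i; rewrite !mxE -sqrtr_sqr ler_sqrt; last by apply: sumr_ge0 => k _; exact: sqr_ge0.
  by rewrite (bigD1 i)//= lerDl; apply: sumr_ge0 => k _; exact: sqr_ge0.
exists (e / (Num.sqrt n%:R + 1)); first by rewrite divr_gt0// ltr_wpDl// sqrtr_ge0.
move=> y Dy xy; apply: le_lt_trans (lesum _ _) _; rewrite siso.
apply: le_lt_trans (sumle _ _) _.
apply: (@le_lt_trans _ _ ((Num.sqrt n%:R + 1) * `|x - y|)).
  by rewrite ler_wpM2r// lerDl.
by rewrite mulrC -ltr_pdivlMr// ltr_wpDl// sqrtr_ge0.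
Qed.

Lemma powR_eventually (R : realType) (p K : R) : 0 < p -> 0 < K ->
  exists2 e0 : R, 0 < e0 & forall e, 0 < e < e0 -> K * e `^ p <= 1.
Proof.
move=> p0 K0; exists (K^-1 `^ p^-1); first by apply: powR_gt0; rewrite invr_gt0.
move=> e /andP[e0 eK]; rewrite mulrC -ler_pdivlMr// mul1r.
have -> : K^-1 = (K^-1 `^ p^-1) `^ p.
  by rewrite -powRrM mulVf ?lt0r_neq0// powRr1// invr_ge0 ltW.
by apply: ge0_ler_powR; rewrite ?nnegrE ?powR_ge0// ltW.
Qed.

Section BadPoints.
Variables (R : realType) (E H : completeNormedModType R).
Variables (dotH : {dot H for idfun}) (j : {linear E -> H}) (mu : R) (phi : E -> R).
Variables (n : nat) (D : set 'rV[R]_n) (C alpha r rho t beta : R).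
Local Notation q := (pullback dotH j).
Local Notation S := (sphere q mu).
Hypotheses (jE : hilbert_embedding dotH j) (qE : weak_inner q) (mu0 : 0 < mu).
Hypotheses (phiC2 : C2 phi) (cD : compact D).
Hypothesis loc : forall rho s u v w, S u -> S v -> `|u| < r - 1 ->
  `|v - u| <= rho -> C * rho <= 1 -> q u w = 0 -> `|w| <= 1 -> 0 <= s ->
  s <= rho -> step_estimate q mu phi (fun u => 'd phi u) (hess phi) alpha C rho s u v w.
Hypotheses (C1 : 1 <= C) (alpha01 : 0 < alpha <= 1) (rho0 : 0 < rho).
Hypotheses (Crho : C * rho <= 1) (trho : t <= rho) (beta0 : 0 < beta).
Hypothesis Crhoa : C * rho `^ alpha <= beta / 8.

(** A bad point either has a steep tangent direction, or a negative space that is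
    not of dimension at most [n] and so contains [n + 1] independent vectors. *)
Lemma bad_point_descent u : S u -> `|u| < r - 1 ->
  ~ ((constrained_norm q mu phi u <= (3 * beta)%:E)%E /\
     (forall W : {pred E}, submod_closed W ->
        (forall w, w \in W -> tangent q u w) ->
        (forall w, w \in W -> w != 0 -> D2 q phi u w w < - beta * `|w| ^+ 2) ->
        dim_le W n)) ->
  descent_near q mu phi D C rho t (beta / 4) u.
Proof.
move=> Su ur bad; have [dphi _ _] := phiC2.
have [cn|cn] := leP (constrained_norm q mu phi u) (3 * beta)%:E; last first.
  have [_ [v [uv v1] <-]] := ereal_sup_gt cn.
  rewrite lte_fin (sphere_diffE jE)// => vbig.
  have [w [uw w1 dw]] : exists w, [/\ q u w = 0, `|w| <= 1 & 'd phi u w <= - (3 * beta)].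
    move: vbig; rewrite real_ltr_normr ?num_real// => /orP[vb|vb].
      exists (- v); split; rewrite ?normrN//.
        by rewrite (innerNr qE) uv oppr0.
      by rewrite diff_valN lerN2 ltW.
    by exists v; split => //; rewrite lerNr ltW.
  exact: (descent_gradient loc C1 alpha01 rho0 Crho trho beta0 Crhoa Su ur uw w1 dw).
have [W [Wsub Wtan Wneg Wdim]] : exists W : {pred E}, [/\ submod_closed W,
    forall w, w \in W -> tangent q u w,
    forall w, w \in W -> w != 0 -> D2 q phi u w w < - beta * `|w| ^+ 2 & ~ dim_le W n].
  apply: contrapT => nW; apply: bad; split => // W W1 W2 W3.
  by apply: contrapT => W4; apply: nW; exists W.
have [B [BW B_free]] := independent_family Wdim.
have comboW (a : 'I_n.+1 -> R) : \sum_i a i *: B i \in W.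
  have [W0 WD] := Wsub; rewrite unfold_in /=.
  elim/big_ind: _ => [//|x y Wx Wy|i _].
    by have := WD 1 x y Wx Wy; rewrite scale1r.
  by have := WD (a i) (B i) 0 (BW i) W0; rewrite addr0.
apply: (descent_hess qE loc C1 rho0 Crho trho beta0 Crhoa cD Su ur _ _ _ B_free) => //.
- by move=> w; exact: slope_continuous.
- by move=> v w x; exact: diff_valD.
- by move=> v a w; exact: diff_valZ.
- move=> a; set w := \sum_i _ *: _; have wW : w \in W := comboW a.
  split; first exact: Wtan.
  have [->|w0] := eqVneq w 0.
    by rewrite hess0l// (inner0l qE) mulr0 subr0 normr0 expr0n mulr0.
  by have /ltW := Wneg w wW w0; rewrite /D2 Su.
Qed.

End BadPoints.

(** * Scales *)

(** With [t = eps `^ a] and [a = 1 / (alpha + 2)] the two conditions are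
    [a * alpha > alpha1] and [alpha1 + 2 * a < 1]; both follow from the bound on
    [alpha1], and hold with room for the constants when [eps] is small. *)
Lemma step_scales (R : realType) (alpha alpha1 C P : R) :
  0 < alpha <= 1 -> 0 < alpha1 <= alpha / (2 * (alpha + 2)) -> 1 <= C -> 1 <= P ->
  exists2 e0 : R, 0 < e0 & forall eps, 0 < eps < e0 ->
    exists2 t, 0 < t & [/\ C * (P * t) <= 1,
      C * (P * t) `^ alpha <= eps `^ alpha1 / 8
    & 3 * eps <= eps `^ alpha1 / 4 * t ^+ 2].
Proof.
move=> /andP[a0 a1] /andP[b0 b1] C1 P1.
have C0 : 0 < C := lt_le_trans ltr01 C1; have P0 : 0 < P := lt_le_trans ltr01 P1.
pose a := (alpha + 2)^-1; have a_gt0 : 0 < a by rewrite invr_gt0; lra.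
have b1' : alpha1 <= alpha * a / 2 by rewrite /a -mulrA -invfM [_ * 2]mulrC.
have aE : alpha * a = 1 - 2 * a by rewrite /a; field; lra.
have aa : 0 < alpha * a by rewrite mulr_gt0.
have p2 : 0 < a * alpha - alpha1 by rewrite mulrC; lra.
have p3 : 0 < 1 - alpha1 - a * 2 by lra.
have [e1 e10 H1] := powR_eventually a_gt0 (mulr_gt0 C0 P0).
have [e2 e20 H2] := powR_eventually p2 (mulr_gt0 (mulr_gt0 C0 P0) (ltr0n R 8)).
have [e3 e30 H3] := powR_eventually p3 (ltr0n R 12).
exists (Num.min e1 (Num.min e2 e3)); first by rewrite !lt_min e10 e20 e30.
move=> eps /andP[eps0]; rewrite !lt_min => /and3P[l1 l2 l3].
have {}H1 := H1 eps; have {}H2 := H2 eps; have {}H3 := H3 eps.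
rewrite eps0 in H1 H2 H3; move: (H1 l1) (H2 l2) (H3 l3) => {H1 H2 H3} H1 H2 H3.
have b_gt0 : 0 < eps `^ alpha1 by rewrite powR_gt0.
have epsn0 (b : bool) : b ==> (eps != 0) by rewrite gt_eqF// implybT.
exists (eps `^ a); first by rewrite powR_gt0.
split; first by rewrite mulrA.
- rewrite powRM ?powR_ge0 ?(ltW P0)// -powRrM.
  have Pa : P `^ alpha <= P by rewrite -[leRHS](powRr1 (ltW P0)); exact: ler_powR.
  have -> : eps `^ (a * alpha) = eps `^ (a * alpha - alpha1) * eps `^ alpha1.
    by rewrite -powRD ?subrK// gt_eqF ?implybT.
  set X := eps `^ (a * alpha - alpha1) in H2 *; set Y := eps `^ alpha1 in b_gt0 *.
  have X0 : 0 <= X := powR_ge0 _ _.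
  apply: (@le_trans _ _ (C * (P * (X * Y)))).
    by rewrite ler_pM2l// ler_wpM2r// mulr_ge0// ltW.
  have -> : C * (P * (X * Y)) = (C * P * 8 * X) * (Y / 8) by field.
  by rewrite ler_piMl// divr_ge0// ltW.
- have -> : eps `^ a ^+ 2 = eps `^ (a * 2) by rewrite powRrM powR_mulrn// powR_ge0.
  have -> : 3 * eps = eps `^ alpha1 / 4 * eps `^ (a * 2) * (12 * eps `^ (1 - alpha1 - a * 2)).
    have -> : eps `^ alpha1 / 4 * eps `^ (a * 2) * (12 * eps `^ (1 - alpha1 - a * 2)) =
       3 * (eps `^ alpha1 * eps `^ (a * 2) * eps `^ (1 - alpha1 - a * 2)) by field.
    rewrite -!powRD ?epsn0//; congr (3 * _).
    have -> : alpha1 + a * 2 + (1 - alpha1 - a * 2) = 1 by ring.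
    by rewrite powRr1// ltW.
  by rewrite ler_piMr// mulr_ge0 ?powR_ge0// divr_ge0// ltW.
Qed.

Lemma sup_on_le (R : realType) (E : normedModType R) (phi : E -> R) (A : set E) (a : R) :
  (sup_on phi A <= a%:E)%E <-> forall u, A u -> phi u <= a.
Proof.
split=> [H u Au|H].
  by rewrite -lee_fin; apply: le_trans H; apply: ereal_sup_ubound; exists u.
by apply: ge_ereal_sup => _ [u Au <-]; rewrite lee_fin; exact: H.
Qed.

Lemma sup_on_lt (R : realType) (E : normedModType R) (phi : E -> R) (A : set E) (a : R) :
  (sup_on phi A < a%:E)%E -> exists2 d, 0 < d & forall u, A u -> phi u <= a - d.
Proof.
case e : (sup_on phi A) => [b| |]//.
  rewrite lte_fin => ba; exists (a - b); first by rewrite subr_gt0.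
  by rewrite subKr; apply/sup_on_le; rewrite e.
by move=> _; exists 1 => //; apply/sup_on_le; rewrite e leNye.
Qed.

Definition hat (R : realType) (n : nat) (h : R) (p x : 'rV[R]_n) : R :=
  Num.max 0 (Num.min 1 (2 - `|x - p| / h)).

Lemma hat_bounds (R : realType) (n : nat) (h : R) (p x : 'rV[R]_n) : 0 <= hat h p x <= 1.
Proof. by rewrite /hat le_max lexx /= ge_max ler01 ge_min lexx. Qed.

Lemma hat_eq1 (R : realType) (n : nat) (h : R) (p x : 'rV[R]_n) : 0 < h ->
  `|x - p| <= h -> hat h p x = 1.
Proof.
move=> h0 xh; have : `|x - p| / h <= 1 by rewrite ler_pdivrMr// mul1r.
by move=> ?; rewrite /hat min_l ?max_r//; lra.
Qed.

Lemma hat_neq0 (R : realType) (n : nat) (h : R) (p x : 'rV[R]_n) : 0 < h ->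
  hat h p x != 0 -> `|x - p| < 2 * h.
Proof.
move=> h0; apply: contraNT; rewrite -leNgt -ler_pdivlMr// => xh.
by apply/eqP; rewrite /hat max_l// ge_min; apply/orP; right; lra.
Qed.

Lemma hat_continuous (R : realType) (n : nat) (h : R) (p : 'rV[R]_n) (D : set 'rV[R]_n) :
  {within D, continuous (hat h p)}.
Proof.
apply: continuous_subspaceT => x; rewrite /hat.
have c1 : (2 - `|y - p| / h : R) @[y --> x] --> (2 - `|x - p| / h : R).
  apply: (@cvgB R R _ (nbhs x) _ (fun=> 2)); first exact: cvg_cst.
  apply: cvgM; last exact: cvg_cst.
  by apply: cvg_norm; apply: cvgB; [exact: cvg_id|exact: cvg_cst].
apply: (@continuous_max _ _ (fun=> 0) (fun x : 'rV[R]_n => Num.min 1 (2 - `|x - p| / h)) x).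
  exact: cst_continuous.
apply: (@continuous_min _ _ (fun=> 1) (fun x : 'rV[R]_n => 2 - `|x - p| / h) x) => //.
exact: cst_continuous.
Qed.

(** * From descent to the minimax level *)

(** The charts are the cells of a fine grid that meet the high part of [D]; the
    descent direction of a cell is that of one of its high points.  A cell whose
    hat function is not zero at a point of [D0] would have a high point with
    nearly the same value of [phi], so [D0] is left fixed. *)
Lemma equivariant_lowering (R : realType) (E : normedModType R) (q : E -> E -> R) (mu : R)
    (phi : E -> R) (n : nat) (D D0 : set 'rV[R]_n) (inv : 'rV[R]_n -> 'rV[R]_n)
    (f : 'rV[R]_n -> E) (C rho t c lev eps : R) :
  weak_inner q -> (forall v, sphere q mu v -> phi (- v) = phi v) ->
  continuous phi ->
  involutive inv -> (forall x, D x -> D (inv x)) -> {within D, continuous inv} ->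
  (forall x, D x -> inv x <> x) -> compact D ->
  D0 `<=` D -> (forall x, D0 x -> D0 (inv x)) ->
  0 <= C -> 0 < t -> 0 <= c -> t + C * t * (2 * 2 ^ n)%:R <= rho -> 0 < eps ->
  3 * eps <= c * t ^+ 2 ->
  sphere_map q mu D inv f ->
  (forall x, D x -> phi (f x) <= lev + eps) ->
  (forall x, D0 x -> phi (f x) <= lev - 2 * eps) ->
  (forall x, D x -> lev - eps <= phi (f x) -> descent_near q mu phi D C rho t c (f x)) ->
  exists g, [/\ sphere_map q mu D inv g, forall x, D0 x -> g x = f x
    & forall x, D x -> phi (g x) <= lev - eps / 2].
Proof.
move=> qE phiN phic invK Dinv invc invfix cD D0D D0inv C0 t0 c0 Crho eps0 epst
  fm flev f0 fdesc.
have [fc fS fN] := fm.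
have phifc : {within D, continuous (fun x => phi (f x))}.
  apply/subspace_continuousP => x Dx; have /subspace_continuousP/(_ x Dx) fx := fc.
  exact: (cvg_comp _ _ fx (phic (f x))).
have [d1 d10 fd1] := compact_unif_continuous cD fc t0.
have [d2 d20 fd2] := compact_unif_continuous cD phifc eps0.
have [d3 d30 fd3] : exists2 d : R, 0 < d &
    forall y z, D y -> D z -> `|y - z| < d -> z <> inv y.
  apply: compact_near_diagonal => // x Dx.
  pose e := `|x - inv x|; have e0 : 0 < e.
    by rewrite normr_gt0 subr_eq0; apply/eqP => /esym; exact: invfix.
  have /within_continuousP/(_ x (e / 2) Dx)[|d d0 dP] := invc; first by rewrite divr_gt0.
  exists (Num.min d (e / 2)); first by rewrite lt_min d0 divr_gt0.
  move=> y z Dy Dz; rewrite !lt_min => /andP[xyd _] /andP[_ xz] zE.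
  have := dP y Dy xyd; have := ler_distD z x (inv x).
  by rewrite zE (distrC (inv y)) -/e -zE; lra.
(* A cell and its hat function span less than [3 h]; a point and its image by
   [inv] under the same hat would be closer than [4 h]. *)
pose h := Num.min d1 (Num.min d2 d3) / 4.
have h0 : 0 < h by rewrite divr_gt0// !lt_min d10 d20 d30.
have [hd1 hd2 hd3] : [/\ 4 * h <= d1, 4 * h <= d2 & 4 * h <= d3].
  have -> : 4 * h = Num.min d1 (Num.min d2 d3) by rewrite /h; field.
  by rewrite !ge_min !lexx !orbT.
have [M M0 DM] := compact_coord_bounded cD.
have [I [p [pcov pmult]]] := grid_cover n M0 h0.
pose high x := D x /\ lev - eps <= phi (f x).
(* [0] is a default value for the cells without high points. *)
have /choice[xi xiP] (i : I) : exists y,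
    (exists2 x, high x & `|x - p i| <= h) -> high y /\ `|y - p i| <= h.
  have [[x hx px]|nx] := pselect (exists2 x, high x & `|x - p i| <= h).
    by exists x.
  by exists 0 => ex; case: nx.
pose l := [seq i <- enum I | `[<exists2 x, high x & `|x - p i| <= h>]].
have lP i : i \in l -> high (xi i) /\ `|xi i - p i| <= h.
  by rewrite mem_filter => /andP[/asboolP + _]; exact: xiP.
pose chi i := hat h (p i).
have chi_near i x : i \in l -> chi i x != 0 -> `|xi i - x| < 3 * h.
  move=> /lP[_ xp] /(hat_neq0 h0) xh.
  have := ler_distD (p i) (xi i) x; rewrite (distrC (p i)); lra.
have chi_inv i x : i \in l -> D x -> chi i x != 0 -> chi i (inv x) = 0.
  move=> il Dx /(hat_neq0 h0) xh; apply/eqP; apply: contraT => /(hat_neq0 h0) yh.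
  exfalso; apply: (fd3 x (inv x) Dx (Dinv _ Dx)) => //.
  have := ler_distD (p i) x (inv x); rewrite (distrC (p i)); lra.
(* The total loss over all steps is at most [eps / 2]. *)
pose kappa := eps / (2 * (size l).+1%:R).
have kappa0 : 0 < kappa by rewrite divr_gt0// mulr_gt0.
have kl : kappa * (size l)%:R <= eps / 2.
  rewrite /kappa invfM mulrA -mulrA ler_piMr//; first by rewrite divr_ge0// ltW.
  by rewrite mulrC ler_pdivrMr// mul1r ler_nat.
have cnt x : (count (fun i => chi i x != 0%R) l <= 2 ^ n)%N.
  apply: leq_trans (pmult x); rewrite cardE /enum_mem size_filter.
  rewrite count_filter -enumT.
  apply: sub_count => i /= /andP[cx _]; exact: (hat_neq0 h0 cx).
have [||||||g [gm gid _ gphi]] := @deformation _ _ q mu phi n D inv qE phiN invK Dinv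
  invc C rho t c C0 (ltW t0) c0 I l chi (fun i => f (xi i)) f t kappa (2 * 2 ^ n) fm kappa0.
- by move=> i /lP[[Dx hx] _]; exact: fdesc.
- by move=> i; exact: hat_continuous.
- by move=> i x; exact: hat_bounds.
- move=> i x il Dx cx; split; last exact: chi_inv.
  have [[Dxi _] _] := lP i il.
  rewrite distrC; apply/ltW/fd1 => //.
  by apply: lt_le_trans (chi_near i x il cx) _; lra.
- by move=> x Dx; rewrite mul2n -addnn; exact: leq_add.
- exact: Crho.
exists g; split => // x.
- move=> D0x; apply: gid; first exact: D0D.
  have out y : D0 y -> forall i, i \in l -> chi i y = 0.
    move=> D0y i il; apply/eqP; apply: contraT => /(chi_near i y il) xy.
    have [[Dxi hx] _] := lP i il; have Dy := D0D _ D0y.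
    have xd : `|xi i - y| < d2 by apply: lt_le_trans xy _; lra.
    have := fd2 _ _ Dxi Dy xd; rewrite ltr_norml => /andP[_ fxy].
    by have fy := f0 y D0y; exfalso; lra.
  by move=> i il; rewrite !out//; exact: D0inv.
- move=> Dx; have := gphi x Dx; have := flev x Dx.
  have ct : 0 <= c * t ^+ 2 by rewrite mulr_ge0// sqr_ge0.
  have [hx|hx] := leP (lev - eps) (phi (f x)).
    have -> : has (fun i => chi i x == 1) l.
      have [i pi] := pcov x (fun k => DM x k Dx).
      apply/hasP; exists i; last by rewrite /chi hat_eq1.
      by rewrite mem_filter mem_enum andbT; apply/asboolP; exists x.
    by rewrite mulr1; lra.
  have : 0 <= c * t ^+ 2 * (has (fun i => chi i x == 1) l)%:R by rewrite mulr_ge0.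
  lra.
Qed.

Theorem theorem4p2 (R : realType) (E H : completeNormedModType R)
    (dotE : {dot E for idfun}) (dotH : {dot H for idfun})
    (j : {linear E -> H}) (mu : R) (phi : E -> R) (alpha : R)
    (n : nat) (B : set E) (F : set (set E)) (c r alpha1 : R) :
  hilbert_product dotE -> hilbert_product dotH ->
  infinite_dim E -> infinite_dim H ->
  hilbert_embedding dotH j ->
  0 < mu ->
  let q := pullback dotH j in
  let S := sphere q mu in
  C2 phi ->
  0 < alpha <= 1 -> holder_on_bounded alpha phi ->
  (forall u, S u -> phi (- u) = phi u) ->
  Z2_homotopic_family S n B F ->
  minimax phi F = c%:E -> (sup_on phi B < c%:E)%E ->
  1 < r ->
  0 < alpha1 <= alpha / (2 * (alpha + 2)) ->
  exists2 eps0 : R, 0 < eps0 &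
    forall eps : R, 0 < eps < eps0 ->
    forall A : set E, F A -> (sup_on phi A <= (c + eps)%:E)%E ->
      [set u | A u /\ c - eps <= phi u] `<=` ball (0 : E) (r - 1) ->
      let good (u : E) : Prop :=
        [/\ c - eps <= phi u <= c + eps,
            (constrained_norm q mu phi u <= (3 * eps `^ alpha1)%:E)%E,
            A u
          & forall W : {pred E}, submod_closed W ->
              (forall w, w \in W -> tangent q u w) ->
              (forall w, w \in W -> w != 0 ->
                 D2 q phi u w w < - (eps `^ alpha1) * `|w| ^+ 2) ->
              dim_le W n] in
      exists u_eps : E, [/\ S u_eps, good u_eps & good (- u_eps)].
Proof.
move=> hE hH _ _ jE mu0 q S phiC2 alpha01 phiH phiN famF minF supB r1 alpha1P.
have qE : weak_inner q := weak_inner_pullback hH jE.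
have [dphi _ _] := phiC2.
have [a0 _] := andP alpha01.
have r0 : 0 < r := lt_trans ltr01 r1.
have [M M0 bM] := bounded_derivatives_exist phiC2 phiH r0 a0.
have [C C1 loc] := local_estimate qE mu0 alpha01 r1 M0 bM.
have C0 : 0 < C := lt_le_trans ltr01 C1.
(* A point meets the supports of at most [2 * 2 ^ n] steps of size [C * t]; the
   additional [t] is the oscillation of [f] over a chart. *)
pose P : R := 1 + C * (2 * 2 ^ n)%:R.
have P1 : 1 <= P by rewrite lerDl mulr_ge0// ltW.
have [delta delta0 phiB] := sup_on_lt supB.
have [e1 e10 He1] := step_scales alpha01 alpha1P C1 P1.
exists (Num.min e1 (delta / 2)); first by rewrite lt_min e10 divr_gt0.
move=> eps /andP[eps0]; rewrite lt_min => /andP[epse1 epsd] A FA phiA AK good.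
have [|t t0 [CPt CPta teps]] := He1 eps; first by rewrite eps0.
case: famF => BS [s [D0 [D [eta0 [[sK siso] [_ cD D0D] [sD sD0 sfix]
  [_ etaB _] FE]]]]].
have Ds x : D x -> D (s x) by move=> Dx; rewrite -sD; exists x.
have D0s x : D0 x -> D0 (s x) by move=> Dx; rewrite -sD0; exists x.
have sc := @euclid_isometry_continuous R n s D siso.
have sx x : D x -> s x <> x.
  by move=> Dx sxx; have : [set x | D x /\ s x = x] x by []; rewrite sfix.
move: FA; rewrite FE => -[_ [f [AE fc fS fN feta]]].
have fSD x : D x -> S (f x) by move=> Dx; apply: fS; exists x.
have phiAle := (sup_on_le phi A _).1 phiA.
have Af x : D x -> A (f x) by move=> Dx; rewrite AE; exists x.
have inball u : A u -> c - eps <= phi u -> `|u| < r - 1.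
  move=> Au phiu; have := AK u (conj Au phiu).
  by rewrite -ball_normE /= sub0r normrN.
apply: contrapT => no_good.
pose beta := eps `^ alpha1; have beta0 : 0 < beta by rewrite powR_gt0.
pose rho := P * t; have trho : t <= rho by rewrite /rho ler_peMl// ltW.
have rho0 : 0 < rho := lt_le_trans t0 trho.
have rhoE : t + C * t * (2 * 2 ^ n)%:R <= rho by rewrite /rho /P mulrDl mul1r mulrAC.
have desc x : D x -> c - eps <= phi (f x) ->
    descent_near q mu phi D C rho t (beta / 4) (f x).
  move=> Dx hx.
  have bad u : S u -> A u -> c - eps <= phi u -> ~ good u ->
      descent_near q mu phi D C rho t (beta / 4) u.
    move=> Su Au hu ngood.
    apply: (bad_point_descent jE qE mu0 phiC2 cD loc C1 alpha01 rho0 CPt trho beta0 CPta) => //.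
      exact: inball.
    move=> [cn Wn]; apply: ngood; split => //.
    by rewrite hu; exact: phiAle.
  (* Whichever of [f x] and [- f x] is bad, descent there is descent at [f x]. *)
  have [g1|] := pselect (good (f x)); last by apply: bad => //; [exact: fSD|exact: Af].
  have [g2|g2] := pselect (good (- f x)).
    by exfalso; apply: no_good; exists (f x); split => //; exact: fSD.
  rewrite -[f x]opprK; apply: (descent_nearN qE phiN); apply: bad => //.
  - exact/(sphereN qE)/fSD.
  - by rewrite -fN//; exact/Af/Ds.
  - by rewrite phiN//; exact: fSD.
have phic : continuous phi by move=> u; exact: differentiable_continuous.
have [|x Dx|x D0x|g [[gc gS gN] gid glow]] := equivariant_lowering (lev := c) (D0 := D0)
  qE phiN phic sK Ds sc sx cD D0D D0s (ltW C0) t0 _ rhoE eps0 teps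
  (And3 fc fSD fN) _ _ desc.
- by rewrite divr_ge0// ltW.
- exact/phiAle/Af.
- rewrite feta//; apply: le_trans (phiB _ _) _; first by apply: etaB; exists x.
  by lra.
have : (minimax phi F <= (c - eps / 2)%:E)%E.
  apply: (@le_trans _ _ (sup_on phi (g @` D))).
    apply: ereal_inf_lbound; exists (g @` D) => //; rewrite FE /=.
    have gSD : g @` D `<=` S by move=> _ [x Dx <-]; exact: gS.
    split => //; exists g; split => // x D0x.
    by rewrite gid// feta.
  by apply/sup_on_le => _ [x Dx <-]; exact: glow.
by rewrite minF lee_fin; lra.
Qed.
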